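(* Let $k_0\ge 0$ and let $\{G_k: k\ge k_0\}$ be a compatible family of graphs. Fix $n,d\ge 0$ and a cycle $\gamma\in\tilde C_{d-1}(\mathsf{M}_n;\mathbb{Z})$, regarded as an element of $\tilde H_{d-1}(\mathsf{M}_n;\mathbb{Z})$. For $k\ge k_0$ let $\theta_k:\tilde H_{k-1}(\mathsf{M}(G_k);\mathbb{Z})\to\tilde H_{k-1+d}(\mathsf{M}_{2k+1+n};\mathbb{Z})$ be $\theta_k(z)=z\wedge\gamma^{(2k+1)}$, where $\gamma^{(2k+1)}$ is obtained from $\gamma$ by replacing each vertex $i\in[n]$ by $i+2k+1$. Let $p$ be a prime and $\iota_p$ the identity of $\mathbb{Z}_p$. If $\theta_{k_0}\otimes_{\mathbb{Z}}\iota_p:\tilde H_{k_0-1}(\mathsf{M}(G_{k_0});\mathbb{Z})\otimes\mathbb{Z}_p\to\tilde H_{k_0-1+d}(\mathsf{M}_{2k_0+1+n};\mathbb{Z})\otimes\mathbb{Z}_p$ is injective, then $\theta_k\otimes_{\mathbb{Z}}\iota_p$ is injective for every $k\ge k_0$. If, in addition, the class of $\gamma$ has exponent $p$ in $\tilde H_{d-1}(\mathsf{M}_n;\mathbb{Z})$, then for each $k\ge k_0$ the map $\hat\theta_k:\tilde H_{k-1}(\mathsf{M}(G_k);\mathbb{Z})\otimes_{\mathbb{Z}}\mathbb{Z}_p\to\tilde H_{k-1+d}(\mathsf{M}_{2k+1+n};\mathbb{Z})$, $\hat\theta_k(z\otimes\lambda)=\lambda z\wedge\gamma^{(2k+1)}$,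 is a well-defined injective homomorphism; in particular $\tilde H_{k-1+d}(\mathsf{M}_{2k+1+n};\mathbb{Z})$ contains a subgroup isomorphic to $(\mathbb{Z}_p)^m$ where $m$ is the rank of $\tilde H_{k-1}(\mathsf{M}(G_k);\mathbb{Z})$.
   Context: For a simple graph $G$, $\mathsf{M}(G)$ is the simplicial complex of matchings in $G$ (faces are sets of pairwise disjoint edges of $G$); $\mathsf{M}_n=\mathsf{M}(K_n)$ on vertex set $[n]=\{1,\dots,n\}$. An edge $\{a,b\}$ is written $ab$. $\tilde C,\tilde H$ are reduced simplicial chains and homology; oriented simplices are written $e_0\wedge\cdots\wedge e_d$, and for chains $c,c'$ on disjoint vertex sets, $c\wedge c'$ is the bilinear extension of concatenation $(e_0\wedge\cdots\wedge e_a)\wedge(f_0\wedge\cdots\wedge f_b)=e_0\wedge\cdots\wedge e_a\wedge f_0\wedge\cdots\wedge f_b$ (this induces a map on homology for cycles). A family $\{G_k:k\ge k_0\}$ of graphs is compatible if for each $k\ge k_0$ the vertex set of $G_k$ is $[2k+1]$, and for each $k>k_0$ and each vertex $s$ such that $1s$ is an edge of $G_k$, the induced subgraph of $G_k$ on $[2k+1]\setminus\{1,s\}$ is isomorphic to $G_{k-1}$. *)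

(* Defs.v *)
From HB Require Import structures.
From mathcomp Require Import all_boot all_order all_algebra.
From mathcomp Require Import boolp.
From mathcomp Require Import freeg.

Set Implicit Arguments.
Unset Strict Implicit.
Unset Printing Implicit Defensive.

Import GRing.Theory Num.Theory.

Local Open Scope ring_scope.
Local Open Scope quotient_scope.

Section GeneratedSubgroup.
Variables (V : zmodType) (R : V -> Prop).

Definition subgroup_generated : {pred V} :=
  fun x => `[< forall P : {pred V}, zmod_closed P ->
                 (forall r, R r -> r \in P) -> x \in P >].

Lemma generated_zmod_closed : zmod_closed subgroup_generated.
Proof.
split=> [|x y /asboolP gx /asboolP gy]; apply/asboolP => P clP RP.
  by case: clP.
by case: (clP) => _; apply; [exact: gx | exact: gy].
Qed.

HB.instance Definition _ :=
  GRing.isZmodClosed.Build V subgroup_generated generated_zmod_closed.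

Lemma generatedW r : R r -> r \in subgroup_generated.
Proof. by move=> Rr; apply/asboolP => P _; apply. Qed.

Lemma generated_ker (W : zmodType) (f : {additive V -> W}) :
  (forall r, R r -> f r = 0) -> forall x, x \in subgroup_generated -> f x = 0.
Proof.
move=> fR x /asboolP /(_ (fun y => f y == 0)) gx; apply/eqP/gx; last first.
  by move=> r Rr; rewrite unfold_in; apply/eqP/fR.
split=> [|u v]; rewrite !unfold_in ?raddf0 ?raddfB //.
by move=> /eqP-> /eqP->; rewrite subr0.
Qed.

End GeneratedSubgroup.

Section QuotientLift.
Variables (V W : zmodType) (I : zmodClosed V) (f : {additive V -> W}).
Hypothesis fI : forall x, x \in I -> f x = 0.

Lemma quot_repr_ker x : f (repr (\pi_(Quotient.quot I) x)) = f x.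
Proof.
apply/eqP; rewrite -subr_eq0 -raddfB; apply/eqP/fI.
by rewrite Quotient.idealrBE reprK.
Qed.

Lemma quot_lift_zmod_morphism :
  zmod_morphism (fun q : Quotient.quot I => f (repr q)).
Proof.
move=> x y; rewrite -raddfB.
rewrite -[x in LHS]reprK -[y in LHS]reprK -raddfB.
by rewrite quot_repr_ker.
Qed.

End QuotientLift.

(* Biadditivity already implies balancedness over the integers. *)
Variant tensor_rel (A B : zmodType) : {freeg (A * B)} -> Prop :=
| TensorRelL a a' b :
    tensor_rel (<< (a + a', b) >> - << (a, b) >> - << (a', b) >>)
| TensorRelR a b b' :
    tensor_rel (<< (a, b + b') >> - << (a, b) >> - << (a, b') >>).

Definition tensor (A B : zmodType) : Type :=
  Quotient.quot (subgroup_generated (@tensor_rel A B)).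
HB.instance Definition _ (A B : zmodType) := GRing.Zmodule.on (tensor A B).
HB.instance Definition _ (A B : zmodType) := Quotient.on (tensor A B).

Definition tens (A B : zmodType) (a : A) (b : B) : tensor A B :=
  \pi_(tensor A B) << (a, b) >>.

Section TensorTheory.
Variables (A B : zmodType).

Lemma tensDl (a a' : A) (b : B) : tens (a + a') b = tens a b + tens a' b.
Proof.
apply/eqP; rewrite -subr_eq0 opprD addrA -!(raddfB (\pi_(tensor A B))).
have := generatedW (TensorRelL a a' b).
by rewrite -[X in X \in _]subr0 Quotient.idealrBE raddf0.
Qed.

Lemma tensDr (a : A) (b b' : B) : tens a (b + b') = tens a b + tens a b'.
Proof.
apply/eqP; rewrite -subr_eq0 opprD addrA -!(raddfB (\pi_(tensor A B))).
have := generatedW (TensorRelR a b b').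
by rewrite -[X in X \in _]subr0 Quotient.idealrBE raddf0.
Qed.

Definition biadditive (W : zmodType) (f : A -> B -> W) :=
  (forall a a' b, f (a + a') b = f a b + f a' b) /\
  (forall a b b', f a (b + b') = f a b + f a b').

Lemma tens_biadditive : biadditive (@tens A B).
Proof. by split; [exact: tensDl | exact: tensDr]. Qed.

Variables (W : zmodType) (f : A -> B -> W).

Definition freeg_lift (D : {freeg (A * B)}) : W :=
  fglift (fun ab => f ab.1 ab.2 : zmodule W) D.

Lemma freeg_lift_zmod_morphism : zmod_morphism freeg_lift.
Proof. by move=> x y; rewrite /freeg_lift lift_is_additive. Qed.

HB.instance Definition _ := GRing.isZmodMorphism.Build
  {freeg (A * B)} W freeg_lift freeg_lift_zmod_morphism.

Lemma freeg_liftU a b : freeg_lift << (a, b) >> = f a b.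
Proof. by rewrite /freeg_lift liftU scale1r. Qed.

Definition tensor_lift (t : tensor A B) : W := freeg_lift (repr t).

Hypothesis f_biadditive : biadditive f.

Lemma freeg_lift_ker x : x \in subgroup_generated (@tensor_rel A B) -> freeg_lift x = 0.
Proof.
have [fDl fDr] := f_biadditive.
apply: generated_ker => r; case=> [a a' b|a b b']; rewrite !raddfB /= !freeg_liftU.
  by rewrite fDl addrAC addrK subrr.
by rewrite fDr addrAC addrK subrr.
Qed.

Lemma tensor_lift_zmod_morphism : zmod_morphism tensor_lift.
Proof. exact: quot_lift_zmod_morphism freeg_lift_ker. Qed.

Lemma tensor_liftE a b : tensor_lift (tens a b) = f a b.
Proof. by rewrite -freeg_liftU; apply: quot_repr_ker freeg_lift_ker _. Qed.

End TensorTheory.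

Lemma tensor_ind (A B : zmodType) (P : tensor A B -> Prop) :
    P 0 -> (forall x y, P x -> P y -> P (x - y)) ->
  (forall a b, P (tens a b)) -> forall t, P t.
Proof.
move=> P0 PB Ptens t; rewrite -[t]reprK -[repr t]freeg_sumE raddf_sum /=.
have PN x : P x -> P (- x) by move=> Px; rewrite -sub0r; apply: PB.
have PD x y : P x -> P y -> P (x + y).
  by move=> Px Py; rewrite -[y]opprK; apply/PB/PN.
have PMn x n : P x -> P (x *+ n).
  by move=> Px; elim: n => // n IHn; rewrite mulrS; apply: PD.
apply: (big_ind P) => // -[a b] _.
rewrite -[coeff _ _]intz -freegU_mulz raddfMz /=.
case: (coeff _ _) => n; first by rewrite -pmulrn; exact/PMn/Ptens.
by rewrite NegzE mulrNz; apply: PN; rewrite -pmulrn; exact/PMn/Ptens.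
Qed.

Section TensorMap.
Variables (A B A' B' : zmodType) (f : {additive A -> A'}) (g : {additive B -> B'}).

Definition tensor_map : tensor A B -> tensor A' B' :=
  tensor_lift (fun a b => tens (f a) (g b)).

Lemma tensor_map_biadditive : biadditive (fun a b => tens (f a) (g b)).
Proof. by split=> *; rewrite raddfD ?tensDl ?tensDr. Qed.

Lemma tensor_map_zmod_morphism : zmod_morphism tensor_map.
Proof. exact: tensor_lift_zmod_morphism tensor_map_biadditive. Qed.

HB.instance Definition _ := GRing.isZmodMorphism.Build
  (tensor A B) (tensor A' B') tensor_map tensor_map_zmod_morphism.

Lemma tensor_mapE a b : tensor_map (tens a b) = tens (f a) (g b).
Proof. exact: tensor_liftE tensor_map_biadditive _ _. Qed.

End TensorMap.

(* The exponent of an element is its order. *)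
Definition has_exponent (A : zmodType) (x : A) (m : nat) : Prop :=
  [/\ (0 < m)%N, x *+ m = 0 & forall j, (0 < j < m)%N -> x *+ j <> 0].

Definition independent (A : zmodType) (r : nat) (a : 'I_r -> A) : Prop :=
  forall c : 'I_r -> int, \sum_i a i *~ c i = 0 -> forall i, c i = 0.

Definition has_rank (A : zmodType) (m : nat) : Prop :=
  (exists a : 'I_m -> A, independent a) /\
  forall r (a : 'I_r -> A), independent a -> (r <= m)%N.

(* The default value 0, for groups of infinite rank, is never used for homology
   groups: see homology_zrankP. *)
Definition zrank (A : zmodType) : nat :=
  if pselect (exists m, has_rank A m) is left h then sval (cid h) else 0%N.

Lemma has_rank_unique (A : zmodType) m m' :
  has_rank A m -> has_rank A m' -> m = m'.
Proof.
by move=> [[a ia] mx] [[a' ia'] mx']; apply/eqP; rewrite eqn_leq (mx' _ a) ?(mx _ a').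
Qed.

Lemma zrankP (A : zmodType) m : has_rank A m -> has_rank A (zrank A).
Proof.
by move=> rm; rewrite /zrank; case: pselect => [h|[]]; [case: cid | exists m].
Qed.

Section Chains.
Variable E : finType.
Implicit Types (x y : E) (s t : seq E) (S T : {set E}).

(* The free abelian group on the subsets of E; the basis element at S stands
   for the simplex S oriented by the enumeration order of E (osimplex_enum). *)
Definition chain : Type := {ffun {set E} -> int}.
HB.instance Definition _ := GRing.Zmodule.on chain.

Fixpoint inversions s : nat :=
  if s is x :: s' then
    (count (fun y => (enum_rank y < enum_rank x)%N) s' + inversions s')%N
  else 0%N.

(* The oriented simplex s_0 /\ ... /\ s_d, for s = [:: s_0; ...; s_d]: the sign
   is that of the permutation sorting s. *)
Definition osimplex s : chain :=
  [ffun S => if uniq s && (S == [set x in s])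
             then (-1) ^+ inversions s else 0].

Definition osimplex_boundary s : chain :=
  \sum_(i < size s) osimplex (take i s ++ drop i.+1 s) *~ (-1) ^+ i.

End Chains.

Section ChainMaps.
Variable E : finType.

Definition linear_ext (V : zmodType) (f : seq E -> V) (c : chain E) : V :=
  \sum_(S : {set E}) f (enum S) *~ c S.

Definition boundary : chain E -> chain E := linear_ext (@osimplex_boundary E).

Definition relabel (E' : finType) (f : E -> E') : chain E -> chain E' :=
  linear_ext (fun s => osimplex [seq f x | x <- s]).

Definition wedge (c c' : chain E) : chain E :=
  linear_ext (fun s => linear_ext (fun t => osimplex (s ++ t)) c') c.

End ChainMaps.

Section ChainTheory.
Variable E : finType.
Implicit Types (x y : E) (s t : seq E) (S T : {set E}).

Lemma linear_ext_zmod_morphism (V : zmodType) (f : seq E -> V) :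
  zmod_morphism (linear_ext f).
Proof.
move=> c c'; rewrite /linear_ext -sumrB; apply: eq_bigr => S _.
by rewrite !ffunE mulrzBr.
Qed.

HB.instance Definition _ (V : zmodType) (f : seq E -> V) :=
  GRing.isZmodMorphism.Build (chain E) V (linear_ext f)
    (linear_ext_zmod_morphism f).

HB.instance Definition _ := GRing.Additive.copy (@boundary E)
  (linear_ext (@osimplex_boundary E)).

HB.instance Definition _ (E' : finType) (f : E -> E') :=
  GRing.Additive.copy (relabel f)
    (linear_ext (fun s => osimplex [seq f x | x <- s])).

Lemma wedge_zmod_morphism (c : chain E) : zmod_morphism (wedge c).
Proof.
move=> u v; rewrite /wedge /linear_ext -sumrB; apply: eq_bigr => S _.
rewrite -mulrzBl; congr (_ *~ _).
exact: (linear_ext_zmod_morphism (fun t => osimplex (enum S ++ t)) u v).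
Qed.

HB.instance Definition _ (c : chain E) :=
  GRing.isZmodMorphism.Build (chain E) (chain E) (wedge c)
    (wedge_zmod_morphism c).

Lemma inversions_enum S : inversions (enum S) = 0%N.
Proof.
have: pairwise (fun x y => (enum_rank x < enum_rank y)%N) (enum S).
  have ss : subseq (enum S) (enum E).
    by rewrite {1}/enum_mem enumT; apply: filter_subseq.
  apply: (subseq_pairwise ss).
  case: (pickP E) => [x0 _|E0]; last first.
    by rewrite (_ : enum E = [::]) //; case: (enum E) => // y ? ; have:= E0 y.
  apply/(pairwiseP x0) => i j; rewrite !inE -!cardE => iE jE ij.
  have enumK k : (k < #|E|)%N -> nat_of_ord (enum_rank (nth x0 (enum E) k)) = k.
    move=> kE; rewrite -[k in LHS]/(nat_of_ord (Ordinal kE)) -enum_val_nth.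
    by rewrite enum_valK.
  by rewrite !enumK.
elim: (enum S) => //= x s IHs /andP[/allP xs /IHs ->]; rewrite addn0.
apply/eqP; rewrite eqn0Ngt -has_count -all_predC; apply/allP => y /xs /=.
by rewrite -leqNgt => /ltnW.
Qed.

Lemma set_in_enum S : [set x in enum S] = S.
Proof. by apply/setP=> x; rewrite inE mem_enum. Qed.

Lemma osimplex_enum S T : osimplex (enum S) T = (T == S)%:R.
Proof.
by rewrite ffunE enum_uniq set_in_enum inversions_enum /=; case: eqP.
Qed.

Lemma osimplex_nuniq s : ~~ uniq s -> osimplex s = 0.
Proof. by move=> /negPf nus; apply/ffunP=> T; rewrite !ffunE nus. Qed.

Lemma osimplexE s : uniq s ->
  osimplex s = osimplex (enum [set x in s]) *~ (-1) ^+ inversions s.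
Proof.
move=> us; apply/ffunP=> T; rewrite ffunE us /=.
rewrite -signr_odd; case: odd; rewrite ?expr1 ?expr0 ?mulrNz ?mulr1z ?ffunE;
  rewrite enum_uniq set_in_enum inversions_enum /=; by case: eqP.
Qed.

Lemma linear_ext_osimplex (V : zmodType) (f : seq E -> V) s : uniq s ->
  linear_ext f (osimplex s) = f (enum [set x in s]) *~ (-1) ^+ inversions s.
Proof.
move=> us; rewrite /linear_ext (bigD1 [set x in s]) //= big1 ?addr0.
  by rewrite ffunE us eqxx.
by move=> T /negPf nT; rewrite ffunE us nT mulr0z.
Qed.

Lemma inversions_cat s t : inversions (s ++ t) =
  (inversions s + inversions t +
   \sum_(x <- s) count (fun y => (enum_rank y < enum_rank x)%N) t)%N.
Proof.
elim: s => [|x s IHs] /=; first by rewrite big_nil addn0.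
by rewrite IHs count_cat big_cons addnACA; congr (_ + _)%N; rewrite addnA.
Qed.

Lemma perm_enum_set s : uniq s -> perm_eq (enum [set x in s]) s.
Proof.
by move=> us; apply: uniq_perm => [||x]; rewrite ?enum_uniq ?mem_enum ?inE.
Qed.

Lemma uniq_enum_cat s t : uniq s -> uniq t ->
  uniq (enum [set x in s] ++ enum [set x in t]) = uniq (s ++ t).
Proof.
by move=> us ut; apply: perm_uniq; apply: perm_cat; apply: perm_enum_set.
Qed.

Lemma osimplex_cat s t : uniq s -> uniq t ->
  osimplex (s ++ t) = osimplex (enum [set x in s] ++ enum [set x in t])
     *~ (-1) ^+ (inversions s + inversions t)%N.
Proof.
move=> us ut; have [ust|nst] := boolP (uniq (s ++ t)); last first.
  by rewrite !osimplex_nuniq ?uniq_enum_cat ?mul0rz.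
rewrite osimplexE // [X in _ = X *~ _]osimplexE ?uniq_enum_cat //.
have <- : [set x in s ++ t] = [set x in enum [set x in s] ++ enum [set x in t]].
  by apply/setP=> x; rewrite !inE !mem_cat !mem_enum !inE.
rewrite -mulrzA -exprD; congr (_ *~ _ ^+ _).
rewrite !inversions_cat !inversions_enum addn0 add0n addnC; congr (_ + _)%N.
under eq_bigr do rewrite -(permP (perm_enum_set ut)).
by apply: perm_big; rewrite perm_sym perm_enum_set.
Qed.

Lemma wedge_osimplex s t : uniq s -> uniq t ->
  wedge (osimplex s) (osimplex t) = osimplex (s ++ t).
Proof.
move=> us ut; rewrite /wedge linear_ext_osimplex // linear_ext_osimplex //.
by rewrite -mulrzA -exprD addnC [RHS]osimplex_cat.
Qed.

Lemma osimplex_boundaryE s : uniq s -> osimplex_boundary s =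
  \sum_(x <- s) osimplex (rem x s) *~ (-1) ^+ index x s.
Proof.
case: s => [|x0 s'] us; first by rewrite /osimplex_boundary big_ord0 big_nil.
set s := x0 :: s' in us *; rewrite (big_nth x0) big_mkord.
apply: eq_bigr => i _; rewrite index_uniq //; congr (osimplex _ *~ _).
by rewrite remE index_uniq.
Qed.

Lemma inversions_rem x s : x \in s -> uniq s ->
  odd (index x s + inversions (rem x s)) =
  odd (inversions s + count (fun y => (enum_rank y < enum_rank x)%N) s).
Proof.
move=> /splitPr[s1 s2]; rewrite cat_uniq /= negb_or => /and3P[us1 /andP[xs1 _] _].
rewrite remE index_cat (negPf xs1) /= eqxx addn0 take_size_cat //.
rewrite -cat_rcons drop_size_cat ?size_rcons // cat_rcons.
rewrite !inversions_cat !count_cat /= ltnn add0n.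
rewrite big_split /=.
have -> : (\sum_(y <- s1) (enum_rank x < enum_rank y) =
  size s1 - count (fun y => (enum_rank y < enum_rank x)%N) s1)%N.
  have sumb (a : pred E) r : (\sum_(y <- r) a y = count a r)%N.
    by elim: r => [|y r IHr]; rewrite ?big_nil // big_cons IHr.
  rewrite sumb -(count_predC (fun y => (enum_rank y < enum_rank x)%N)).
  rewrite addKn; apply: eq_in_count => y ys1 /=.
  rewrite -leqNgt [RHS]leq_eqVlt; case: eqP => //= exy.
  have xy : x = y by apply/enum_rank_inj/val_inj.
  by rewrite xy ys1 in xs1.
rewrite !oddD oddB ?count_size //.
move: (odd (size s1)) (odd (inversions s1)) (odd (inversions s2)).
move: (odd (count _ s1)) (odd (count _ s2)) (odd (bigop.body _ _ _)).
by do 6!case. 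
Qed.

Lemma osimplex_boundary_alt s : uniq s ->
  osimplex_boundary s =
  osimplex_boundary (enum [set x in s]) *~ (-1) ^+ inversions s.
Proof.
move=> us; rewrite !osimplex_boundaryE ?enum_uniq // mulrz_suml.
rewrite (perm_big _ (perm_enum_set us)) /=; apply: eq_big_seq => x xs.
have xS : x \in enum [set x in s] by rewrite mem_enum inE.
rewrite osimplexE ?rem_uniq // [in RHS]osimplexE ?rem_uniq ?enum_uniq //.
have <- : [set y in rem x s] = [set y in rem x (enum [set x in s])].
  by apply/setP=> y; rewrite !inE !mem_rem_uniq ?enum_uniq // !inE mem_enum inE.
rewrite -!mulrzA -!exprD; congr (_ *~ _); rewrite -signr_odd -[RHS]signr_odd.
congr (_ ^+ nat_of_bool _).
have := inversions_rem xs us; have := inversions_rem xS (enum_uniq _).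
rewrite inversions_enum add0n (permP (perm_enum_set us)) !oddD.
move: (odd (index x s)) (odd (inversions s)) (odd (count _ s)).
move: (odd (inversions (rem x s))) (odd (inversions (rem _ (enum _)))).
by move: (odd (index _ _)); do 6!case.
Qed.

Lemma boundary_osimplex s : uniq s -> boundary (osimplex s) = osimplex_boundary s.
Proof.
by move=> us; rewrite /boundary linear_ext_osimplex // -osimplex_boundary_alt.
Qed.

Lemma osimplex_boundary_cat s t : osimplex_boundary (s ++ t) =
  \sum_(i < size s) osimplex ((take i s ++ drop i.+1 s) ++ t) *~ (-1) ^+ i +
  (\sum_(i < size t) osimplex (s ++ (take i t ++ drop i.+1 t)) *~ (-1) ^+ i)
    *~ (-1) ^+ size s.
Proof.
rewrite /osimplex_boundary size_cat big_split_ord /= mulrz_suml; congr (_ + _).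
  apply: eq_bigr => i _; rewrite take_cat drop_cat ltn_ord.
  case: ltnP => [_|si]; first by rewrite catA.
  have /eqP e : i.+1 == size s by rewrite eqn_leq si andbT.
  by rewrite e subnn drop0 drop_size cats0.
apply: eq_bigr => i _; rewrite take_cat drop_cat.
rewrite !ltnNge leq_addr /= -addnS leq_addr /= !addKn catA.
by rewrite -mulrzA -exprD addnC.
Qed.

Lemma wedge_boundary s t : uniq (s ++ t) ->
  boundary (wedge (osimplex s) (osimplex t)) =
  wedge (boundary (osimplex s)) (osimplex t) +
  wedge (osimplex s) (boundary (osimplex t)) *~ (-1) ^+ size s.
Proof.
move=> ust; have us : uniq s by move: ust; rewrite cat_uniq => /andP[].
have ut : uniq t by move: ust; rewrite cat_uniq => /and3P[].
rewrite wedge_osimplex // !boundary_osimplex // osimplex_boundary_cat.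
have urem (r : seq E) i : uniq r -> uniq (take i r ++ drop i.+1 r).
  move=> ur; apply: (subseq_uniq _ ur); rewrite -[X in subseq _ X](cat_take_drop i).
  by apply: cat_subseq => //; rewrite -add1n -drop_drop; apply: drop_subseq.
congr (_ + _ *~ _).
  rewrite /osimplex_boundary /wedge raddf_sum; apply: eq_bigr => i _.
  rewrite raddfMz; congr (_ *~ _).
  by rewrite -[RHS]/(wedge (osimplex _) (osimplex t)) wedge_osimplex ?urem.
rewrite /osimplex_boundary raddf_sum; apply: eq_bigr => i _ /=.
by rewrite raddfMz /= wedge_osimplex ?urem.
Qed.

End ChainTheory.
Section ChainTheory2.
Variable E : finType.
Implicit Types (S T : {set E}) (c : chain E).

Lemma enum_set_subseq (s : seq E) S :
  subseq s (enum S) -> enum [set x in s] = s.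
Proof.
move=> sS; have sE : subseq s (enum E).
  by apply: (subseq_trans sS); rewrite {1}/enum_mem enumT; apply: filter_subseq.
rewrite [RHS](subseq_uniqP (enum_uniq E) sE) enumT {1}/enum_mem.
by apply: eq_filter => x; rewrite /= inE.
Qed.

Lemma relabel_boundary (E' : finType) (f : E -> E') c : injective f ->
  boundary (relabel f c) = relabel f (boundary c).
Proof.
move=> f_inj; rewrite {1}/relabel {1}/linear_ext raddf_sum /=.
rewrite [X in relabel f X]/boundary {1}/linear_ext raddf_sum /=.
apply: eq_bigr => S _; rewrite !raddfMz /=; congr (_ *~ _).
rewrite boundary_osimplex ?map_inj_uniq ?enum_uniq //.
rewrite /osimplex_boundary raddf_sum size_map; apply: eq_bigr => i _ /=.
rewrite raddfMz /=; congr (_ *~ _); rewrite -map_take -map_drop -map_cat.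
have ss : subseq (take i (enum S) ++ drop i.+1 (enum S)) (enum S).
  rewrite -[X in subseq _ X](cat_take_drop i).
  by apply: cat_subseq => //; rewrite -add1n -drop_drop; apply: drop_subseq.
rewrite /relabel linear_ext_osimplex ?(subseq_uniq ss) ?enum_uniq //.
have e := enum_set_subseq ss.
by rewrite e -[X in inversions X]e inversions_enum.
Qed.

Lemma wedge_suml (I : Type) (r : seq I) (F : I -> chain E) c :
  wedge (\sum_(i <- r) F i) c = \sum_(i <- r) wedge (F i) c.
Proof. by rewrite /wedge raddf_sum. Qed.

Lemma wedgeMzl c c' n : wedge (c *~ n) c' = wedge c c' *~ n.
Proof. by rewrite /wedge raddfMz. Qed.

Lemma wedge_zmod_morphisml c' : zmod_morphism (fun c => wedge c c').
Proof. by move=> u v; rewrite /wedge raddfB. Qed.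

End ChainTheory2.

Record complex (E : finType) := Complex {
  faces : {set {set E}};
  faces_closed : forall S T : {set E}, S \in faces -> T \subset S -> T \in faces
}.

Section Homology.
Variables (E : finType) (K : complex E).

(* Chain groups, cycles and homology are indexed by the number k of vertices of
   a simplex, so that index k is dimension k - 1; the empty face, with k = 0,
   makes the theory reduced. *)
Definition chain_on (k : nat) : {pred chain E} :=
  [pred c : chain E |
    [forall S, (c S != 0) ==> (S \in faces K) && (#|S| == k)]].

Lemma chain_onP k (c : chain E) :
  reflect (forall S, c S != 0 -> S \in faces K /\ #|S| = k) (c \in chain_on k).
Proof.
rewrite inE; apply: (iffP forallP) => h S; last by apply/implyP=> /h[-> /eqP].
by move=> cS; have /implyP/(_ cS)/andP[? /eqP] := h S.
Qed.

Lemma chain_on_zmod_closed k : zmod_closed (chain_on k).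
Proof.
split=> [|u v /chain_onP uk /chain_onP vk]; apply/chain_onP => S.
  by rewrite ffunE eqxx.
rewrite !ffunE; have [->|/uk //] := eqVneq (u S) 0.
by rewrite sub0r oppr_eq0 => /vk.
Qed.

HB.instance Definition _ k :=
  GRing.isZmodClosed.Build (chain E) (chain_on k) (chain_on_zmod_closed k).

Definition cycle_on (k : nat) : {pred chain E} :=
  [pred c : chain E | (c \in chain_on k) && (boundary c == 0)].

Lemma cycle_on_zmod_closed k : zmod_closed (cycle_on k).
Proof.
split=> [|u v]; rewrite !inE.
  by rewrite raddf0 eqxx andbT; exact: (rpred0 (chain_on k)).
move=> /andP[uk /eqP bu] /andP[vk /eqP bv].
rewrite raddfB /= bu bv subr0 eqxx andbT.
exact: (@rpredB _ (chain_on k)).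
Qed.

HB.instance Definition _ k :=
  GRing.isZmodClosed.Build (chain E) (cycle_on k) (cycle_on_zmod_closed k).

Record zcycle (k : nat) := Cycle {
  cycle_val :> chain E;
  cycleP : cycle_val \in cycle_on k
}.

HB.instance Definition _ k := [isSub for @cycle_val k].
HB.instance Definition _ k := [Choice of zcycle k by <:].
HB.instance Definition _ k := [SubChoice_isSubZmodule of zcycle k by <:].

Lemma cycle_val_zmod_morphism k : zmod_morphism (@cycle_val k).
Proof. by []. Qed.

HB.instance Definition _ k := GRing.isZmodMorphism.Build (zcycle k) (chain E)
  (@cycle_val k) (@cycle_val_zmod_morphism k).

Definition is_boundary (k : nat) : {pred zcycle k} :=
  fun z => `[< exists2 b, b \in chain_on k.+1 & cycle_val z = boundary b >].

Lemma is_boundary_zmod_closed k : zmod_closed (@is_boundary k).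
Proof.
split=> [|u v /asboolP[b bk ub] /asboolP[c ck vc]]; apply/asboolP.
  by exists 0; rewrite ?raddf0 ?rpred0.
by exists (b - c); rewrite ?rpredB // [RHS]raddfB /= -ub -vc.
Qed.

HB.instance Definition _ k := GRing.isZmodClosed.Build (zcycle k)
  (@is_boundary k) (@is_boundary_zmod_closed k).

Definition homology (k : nat) : Type := Quotient.quot (@is_boundary k).
HB.instance Definition _ k := GRing.Zmodule.on (homology k).
HB.instance Definition _ k := Quotient.on (homology k).

Definition homology_class k (z : zcycle k) : homology k := \pi_(homology k) z.

Lemma homology_class_zmod_morphism k : zmod_morphism (@homology_class k).
Proof. by move=> x y; rewrite /homology_class raddfB. Qed.

HB.instance Definition _ k := GRing.isZmodMorphism.Build (zcycle k) (homology k)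
  (@homology_class k) (@homology_class_zmod_morphism k).

Lemma homology_class_eq0 k (z : zcycle k) :
  homology_class z = 0 <->
  exists2 b, b \in chain_on k.+1 & cycle_val z = boundary b.
Proof.
rewrite -(raddf0 (@homology_class k)); split=> [/eqP|bz]; last apply/eqP.
  by rewrite -Quotient.idealrBE subr0 => /asboolP.
by rewrite -Quotient.idealrBE subr0; apply/asboolP.
Qed.

End Homology.

Section HomologyRank.
Variables (E : finType) (K : complex E) (k : nat).

Lemma chainMz (c : chain E) (n : int) S : (c *~ n) S = c S * n.
Proof.
case: n => n; last rewrite NegzE mulrNz ffunE mulrN; rewrite -pmulrn.
  by rewrite ffunMnE -mulr_natr natz.
by rewrite ffunMnE -mulr_natr natz.
Qed.

Lemma independent_leq r (a : 'I_r -> homology K k) :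
  independent a -> (r <= #|{set E}|)%N.
Proof.
move=> ind; rewrite leqNgt; apply/negP => ltr.
pose z i : chain E := cycle_val (repr (a i)).
pose M : 'M[rat]_(r, #|{set E}|) := \matrix_(i, j) (z i (enum_val j))%:~R.
have : kermx M != 0.
  rewrite kermx_eq0 /row_free neq_ltn; apply/orP; left.
  exact: leq_ltn_trans (rank_leq_col M) ltr.
move=> /rowV0Pn[v /sub_kermxP vM v0].
pose c i : int := numq (v 0 i) * \prod_(j | j != i) denq (v 0 j).
pose D : rat := \prod_j (denq (v 0 j))%:~R.
have D0 : D != 0 by apply/prodf_neq0 => j _; rewrite intr_eq0 denq_neq0.
have cE i : (c i)%:~R = v 0 i * D.
  by rewrite /D (bigD1 i) //= mulrA -numqE rmorphM /= rmorph_prod.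
have cz : \sum_i z i *~ c i = 0.
  apply/ffunP => S; rewrite sum_ffunE ffunE.
  apply: (@intr_inj rat); rewrite rmorph_sum /= rmorph0.
  have /rowP/(_ (enum_rank S)) := vM; rewrite !mxE => vMS.
  transitivity (D * \sum_j v 0 j * M j (enum_rank S)); last by rewrite vMS mulr0.
  rewrite mulr_sumr; apply: eq_bigr => i _.
  by rewrite chainMz rmorphM /= cE mxE enum_rankK mulrC mulrCA mulrA.
have c0 : forall i, c i = 0.
  apply: ind; rewrite -[RHS](raddf0 (@homology_class E K k)).
  transitivity (homology_class (\sum_i repr (a i) *~ c i)).
    rewrite raddf_sum; apply: eq_bigr => i _; rewrite raddfMz /=.
    by rewrite /homology_class reprK.
  congr homology_class; apply: val_inj; rewrite /= raddf_sum -[RHS]cz.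
  by apply: eq_bigr => i _; rewrite raddfMz.
case/negP: v0; apply/eqP/rowP => i; rewrite mxE.
have := cE i; rewrite c0 rmorph0 => /esym/eqP.
by rewrite mulf_eq0 (negPf D0) orbF => /eqP.
Qed.

Lemma homology_zrankP : has_rank (homology K k) (zrank (homology K k)).
Proof.
pose P r := `[< exists a : 'I_r -> homology K k, independent a >].
have exP : exists r, P r.
  by exists 0%N; apply/asboolP; exists (fun=> 0) => c _ [].
have ubP r : P r -> (r <= #|{set E}|)%N.
  by move=> /asboolP[a]; apply: independent_leq.
case: (ex_maxnP exP ubP) => m /asboolP am maxm.
apply: (@zrankP _ m); split=> // r a ia.
by apply: maxm; apply/asboolP; exists a.
Qed.

End HomologyRank.

Record sgraph (V : finType) := SGraph {
  adj : rel V;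
  adj_sym : symmetric adj;
  adj_irrefl : irreflexive adj
}.

Definition edges (V : finType) (G : sgraph V) : {set {set V}} :=
  [set [set u.1; u.2] | u : V * V & adj G u.1 u.2].

Section InducedSubgraph.
Variables (V : finType) (G : sgraph V) (A : {set V}).

Definition induced_adj : rel {x : V | x \in A} :=
  fun x y => adj G (val x) (val y).

Lemma induced_adj_sym : symmetric induced_adj.
Proof. by move=> x y; apply: adj_sym. Qed.

Lemma induced_adj_irrefl : irreflexive induced_adj.
Proof. by move=> x; apply: adj_irrefl. Qed.

Definition induced : sgraph {x : V | x \in A} :=
  SGraph induced_adj_sym induced_adj_irrefl.

End InducedSubgraph.

Definition graph_isomorphic (V W : finType) (G : sgraph V) (H : sgraph W) : Prop :=
  exists2 f : V -> W, bijective f & forall x y, adj H (f x) (f y) = adj G x y.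

Section CompleteGraph.
Variable n : nat.

Lemma complete_adj_sym : symmetric (fun i j : 'I_n => i != j).
Proof. by move=> i j; rewrite eq_sym. Qed.

Lemma complete_adj_irrefl : irreflexive (fun i j : 'I_n => i != j).
Proof. by move=> i; rewrite eqxx. Qed.

Definition complete_graph : sgraph 'I_n := SGraph complete_adj_sym complete_adj_irrefl.

End CompleteGraph.

Section MatchingComplex.
Variables (V : finType) (G : sgraph V).

Definition matchings : {set {set {set V}}} :=
  [set S : {set {set V}} | (S \subset edges G) && trivIset S].

Lemma matchings_closed (S T : {set {set V}}) :
  S \in matchings -> T \subset S -> T \in matchings.
Proof.
rewrite !inE => /andP[SG trS] TS; rewrite (subset_trans TS SG) /=.
exact: trivIsetS TS trS.
Qed.

Definition matching_complex : complex {set V} := Complex matchings_closed.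

End MatchingComplex.

(* Ordinals start at 0, so the vertex 1 of [2k + 1] is ord0. The members G k
   with k < k0 are unconstrained and play no role. *)
Definition compatible (k0 : nat) (G : forall k, sgraph 'I_(k.*2.+1)) : Prop :=
  forall k, (k0 < k)%N -> forall s : 'I_(k.*2.+1), adj (G k) ord0 s ->
    graph_isomorphic (induced (G k) (~: [set ord0; s])) (G k.-1).

Section Theta.
Variables (m n : nat) (G : sgraph 'I_m) (k d : nat).

Definition edge_inl (e : {set 'I_m}) : {set 'I_(m + n)} :=
  [set lshift n i | i in e].

(* On [n], rshift m is i |-> i + m. *)
Definition edge_shift (e : {set 'I_n}) : {set 'I_(m + n)} :=
  [set rshift m i | i in e].

Definition join (z : chain {set 'I_m}) (c : chain {set 'I_n}) :
    chain {set 'I_(m + n)} :=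
  wedge (relabel edge_inl z) (relabel edge_shift c).

Lemma edge_inl_inj : injective edge_inl.
Proof. exact/imset_inj/lshift_inj. Qed.

Lemma edge_shift_inj : injective edge_shift.
Proof. exact/imset_inj/rshift_inj. Qed.

Lemma edges_neq0 (V : finType) (H : sgraph V) e : e \in edges H -> e != set0.
Proof. by move=> /imsetP[u _ ->]; apply/set0Pn; exists u.1; rewrite !inE eqxx. Qed.

Lemma edge_complete (V : finType) (H : sgraph V) p (f : V -> 'I_p) e :
  injective f -> e \in edges H -> [set f x | x in e] \in edges (complete_graph p).
Proof.
move=> f_inj /imsetP[[x y]] /= xy ->; apply/imsetP; exists (f x, f y) => /=.
  rewrite inE /= (inj_eq f_inj); apply: contraTneq xy => ->.
  by rewrite inE /= adj_irrefl.
by rewrite imsetU !imset_set1.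
Qed.

Lemma edge_inl_shift_disjoint e e' : [disjoint edge_inl e & edge_shift e'].
Proof.
rewrite -setI_eq0; apply/eqP/setP => x; rewrite !inE; apply/negP.
by move=> /andP[/imsetP[i _ ->] /imsetP[j _ /eqP]]; rewrite eq_lrshift.
Qed.

Definition join_seq (S : {set {set 'I_m}}) (T : {set {set 'I_n}}) :=
  [seq edge_inl e | e <- enum S] ++ [seq edge_shift e | e <- enum T].

Lemma join_seq_uniq S T : S \in faces (matching_complex G) ->
  uniq (join_seq S T).
Proof.
rewrite inE => /andP[/subsetP SG _]; rewrite cat_uniq.
rewrite !map_inj_uniq ?enum_uniq ?andbT /=; try exact: edge_inl_inj;
  try exact: edge_shift_inj.
apply/hasPn => _ /mapP[e' _ ->]; apply/negP => /mapP[e]; rewrite mem_enum.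
move=> /SG/edges_neq0 /set0Pn[i ie] ee'.
have := edge_inl_shift_disjoint e e'; rewrite ee' -setI_eq0 setIid.
by move/eqP/setP/(_ (lshift n i)); rewrite inE imset_f.
Qed.

Lemma join_seq_face S T :
  S \in faces (matching_complex G) -> T \in faces (matching_complex (complete_graph n)) ->
  [set x in join_seq S T] \in faces (matching_complex (complete_graph (m + n))).
Proof.
rewrite !inE => /andP[/subsetP SG /trivIsetP trS] /andP[/subsetP TG /trivIsetP trT].
apply/andP; split.
  apply/subsetP => x; rewrite inE mem_cat.
  case/orP => /mapP[e]; rewrite mem_enum => eS ->.
    by apply: (edge_complete (@lshift_inj _ _)); exact: SG eS.
  by apply: (edge_complete (@rshift_inj _ _)); exact: TG eS.
have imdisj (V W : finType) (f : V -> W) (A B : {set V}) : injective f ->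
    [disjoint A & B] -> [disjoint [set f x | x in A] & [set f x | x in B]].
  by move=> f_inj; rewrite -!setI_eq0 -imsetI ?imset_eq0 // => x y _ _ /f_inj.
apply/trivIsetP => A B; rewrite !inE !mem_cat.
case/orP => /mapP[e]; rewrite mem_enum => eS ->;
  case/orP => /mapP[e']; rewrite mem_enum => eS' -> ne.
- apply: imdisj; first exact: lshift_inj.
  by apply: trS => //; apply: contraNneq ne => ->.
- exact: edge_inl_shift_disjoint.
- by rewrite disjoint_sym; exact: edge_inl_shift_disjoint.
- apply: imdisj; first exact: rshift_inj.
  by apply: trT => //; apply: contraNneq ne => ->.
Qed.

Lemma wedge_relabel
    (F H : {additive chain {set 'I_(m + n)} -> chain {set 'I_(m + n)}}) z c :
  wedge (F (relabel edge_inl z)) (H (relabel edge_shift c)) =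
  \sum_(S : {set {set 'I_m}}) \sum_(T : {set {set 'I_n}})
    wedge (F (osimplex [seq edge_inl e | e <- enum S]))
          (H (osimplex [seq edge_shift e | e <- enum T])) *~ (z S * c T).
Proof.
rewrite {1}/relabel {1}/linear_ext raddf_sum wedge_suml; apply: eq_bigr => S _.
rewrite raddfMz wedgeMzl {1}/relabel {1}/linear_ext !raddf_sum mulrz_suml.
by apply: eq_bigr => T _; rewrite !raddfMz -mulrzA [c T * _]mulrC.
Qed.

Lemma joinE z c : join z c =
  \sum_S \sum_T osimplex (join_seq S T) *~ (z S * c T).
Proof.
rewrite /join (wedge_relabel idfun idfun); apply: eq_bigr => S _.
apply: eq_bigr => T _; rewrite wedge_osimplex ?map_inj_uniq ?enum_uniq //;
  [exact: edge_inl_inj | exact: edge_shift_inj].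
Qed.

Lemma join_chain p q z c :
  z \in chain_on (matching_complex G) p ->
  c \in chain_on (matching_complex (complete_graph n)) q ->
  join z c \in chain_on (matching_complex (complete_graph (m + n))) (p + q).
Proof.
move=> /chain_onP zp /chain_onP cq; rewrite joinE.
apply: rpred_sum => S _; apply: rpred_sum => T _.
have [->|/zp[SG Sp]] := eqVneq (z S) 0; first by rewrite mul0r rpred0.
have [->|/cq[TG Tq]] := eqVneq (c T) 0; first by rewrite mulr0 rpred0.
apply: rpredMz; apply/chain_onP => U; rewrite ffunE.
case: ifP => [/andP[us /eqP->] _|_]; last by rewrite eqxx.
split; first exact: join_seq_face.
by rewrite cardsE (card_uniqP us) size_cat !size_map -!cardE Sp Tq.
Qed.

Lemma join_boundary p z c :
  z \in chain_on (matching_complex G) p ->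
  boundary (join z c) = join (boundary z) c + join z (boundary c) *~ (-1) ^+ p.
Proof.
move=> /chain_onP zp; rewrite /join -!relabel_boundary;
  [|exact: edge_shift_inj|exact: edge_inl_inj].
rewrite (wedge_relabel (@boundary _) idfun) (wedge_relabel idfun (@boundary _)).
rewrite (wedge_relabel idfun idfun) raddf_sum mulrz_suml -big_split /=.
apply: eq_bigr => S _; rewrite raddf_sum mulrz_suml -big_split /=.
apply: eq_bigr => T _; rewrite raddfMz /=.
have [->|/zp[SG Sp]] := eqVneq (z S) 0; first by rewrite mul0r !mulr0z mul0rz addr0.
rewrite wedge_boundary; last exact: join_seq_uniq.
by rewrite size_map -cardE Sp mulrzDl -!mulrzA [_ * (-1) ^+ p]mulrC.
Qed.

Lemma join_zmod_morphisml c : zmod_morphism (fun z => join z c).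
Proof. by move=> u v; rewrite /join raddfB wedge_zmod_morphisml. Qed.

Lemma join_cycle_subproof (z : zcycle (matching_complex G) k)
    (c : zcycle (matching_complex (complete_graph n)) d) :
  join z c \in cycle_on (matching_complex (complete_graph (m + n))) (k + d).
Proof.
have /andP[zk /eqP bz] := cycleP z; have /andP[cd /eqP bc] := cycleP c.
rewrite inE join_chain //= (join_boundary _ zk) bz bc.
by rewrite /join !raddf0 mul0rz addr0 -{1}(subrr 0) wedge_zmod_morphisml subrr.
Qed.

Definition join_cycle z c := Cycle (join_cycle_subproof z c).

Variable gamma : zcycle (matching_complex (complete_graph n)) d.

Definition join_class (z : zcycle (matching_complex G) k) :
    homology (matching_complex (complete_graph (m + n))) (k + d) :=
  homology_class (join_cycle z gamma).

Lemma join_class_zmod_morphism : zmod_morphism join_class.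
Proof.
move=> u v; rewrite /join_class -raddfB; congr homology_class.
by apply: val_inj; rewrite raddfB /= join_zmod_morphisml.
Qed.

HB.instance Definition _ := GRing.isZmodMorphism.Build
  (zcycle (matching_complex G) k) _ join_class join_class_zmod_morphism.

Lemma join_class_boundary z : z \in @is_boundary _ _ k -> join_class z = 0.
Proof.
move=> /asboolP[b bk zb]; apply/homology_class_eq0; exists (join b gamma).
  by rewrite -addSn; apply: join_chain => //; case/andP: (cycleP gamma).
rewrite (join_boundary _ bk) -zb.
have /andP[_ /eqP->] := cycleP gamma.
by rewrite /join !raddf0 mul0rz addr0.
Qed.

(* [z] |-> [z /\ gamma^(m)], by thetaE. *)
Definition theta (h : homology (matching_complex G) k) :
    homology (matching_complex (complete_graph (m + n))) (k + d) :=
  join_class (repr h).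

Lemma theta_zmod_morphism : zmod_morphism theta.
Proof. exact: quot_lift_zmod_morphism join_class_boundary. Qed.

HB.instance Definition _ := GRing.isZmodMorphism.Build
  (homology (matching_complex G) k) _ theta theta_zmod_morphism.

Lemma thetaE z :
  theta (homology_class z) = homology_class (join_cycle z gamma).
Proof. exact: quot_repr_ker join_class_boundary z. Qed.

End Theta.

Arguments theta {m n} G k {d} gamma h.

(* Main.v *)
From HB Require Import structures.
Require Import Defs.
From mathcomp Require Import all_boot all_order all_algebra.
From mathcomp Require Import boolp.

Set Implicit Arguments.
Unset Strict Implicit.
Unset Printing Implicit Defensive.

Import GRing.Theory Num.Theory.
Local Open Scope ring_scope.

(* Injectivity of theta_k (x) Z_p means that every cycle z whose join with gamma
   is p times a cycle, up to a boundary, is itself p times a cycle. This passes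
   from k to k + 1: for each neighbour s of vertex 1, taking the link of the edge
   1s anticommutes with the boundary and commutes with joining gamma, so the link
   of z in G_{k+1} - {1, s}, a copy of G_k, satisfies the same hypothesis and is
   divisible by p. Hence so is the coefficient in z of every matching that covers
   vertex 1. Any other matching in z is a perfect matching of the remaining
   vertices, and the vanishing of the boundary at one of its facets expresses its
   coefficient through coefficients of matchings that do cover vertex 1.
   If p gamma is a boundary, then p kills the image of theta_k, so theta_k (x) Z_p
   lifts to the homology itself; a basis of top cycles extracted by the Smith
   normal form stays independent modulo p. *)

(** * Divisibility by p and tensor products with Z_p *)

Section Multiples.
Variables (A : zmodType) (p : nat).

Definition multiples : {pred A} := fun x => `[< exists y, x = y *+ p >].

Lemma multiples_zmod_closed : zmod_closed multiples.
Proof.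
split=> [|x y /asboolP[u ->] /asboolP[v ->]]; apply/asboolP.
  by exists 0; rewrite mul0rn.
by exists (u - v); rewrite mulrnBl.
Qed.

HB.instance Definition _ :=
  GRing.isZmodClosed.Build A multiples multiples_zmod_closed.

End Multiples.

Section TensorZp.
Variables (p : nat) (p_gt1 : (1 < p)%N).

(** A residue acts here through its canonical representative in the naturals. The reduction modulo
    [p] performed by the sum of residues goes unnoticed because [p] kills [x]. *)
Lemma mulrn_Zp_add (A : zmodType) (x : A) (b b' : 'Z_p) : x *+ p = 0 ->
  x *+ (b + b')%R = x *+ b + x *+ b'.
Proof.
move=> xp; rewrite -mulrnDr [in RHS](divn_eq (b + b') p) mulrnDr mulnC mulrnA xp.
by rewrite mul0rn add0r; congr (x *+ _) => /=; congr (_ %% _)%N; exact: Zp_cast.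
Qed.

Variable A : zmodType.

Lemma tensMnl (B : zmodType) (a : A) (b : B) n : tens (a *+ n) b = tens a (b *+ n).
Proof.
elim: n => [|n IHn]; last by rewrite !mulrS tensDl tensDr IHn.
rewrite !mulr0n; transitivity (0 : tensor A B).
  by apply: (addrI (tens 0 b)); rewrite -tensDl !addr0.
by apply: (addrI (tens a 0)); rewrite -tensDr !addr0.
Qed.

Lemma tens_Zp (a : A) (b : 'Z_p) : tens a b = tens (a *+ b) 1.
Proof. by rewrite tensMnl natr_Zp. Qed.

Lemma tens0l (B : zmodType) (b : B) : tens 0 b = 0 :> tensor A B.
Proof. by apply: (addrI (tens 0 b)); rewrite -tensDl !addr0. Qed.

(** Since 1 generates Z_p, the right factor of an elementary tensor can be moved to the left;
    tensors with the same right factor then add up to one tensor. *)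
Lemma tens1_surj (t : tensor A 'Z_p) : exists a, t = tens a 1.
Proof.
elim/tensor_ind: t => [|_ _ [a ->] [b ->]|a b]; last by exists (a *+ b); exact: tens_Zp.
  by exists 0; rewrite tens0l.
exists (a - b); apply: (addIr (tens b 1)).
by rewrite -tensDl !subrK.
Qed.

(** This is A (x) Z_p = A / pA. From left to right, the pairing of [a] and [b] to the class of [b]
    times [a] in A / pA is biadditive, as [p] kills that quotient, and its lift sends [tens a 1] to
    the class of [a]. *)
Lemma tens1_eq0 (a : A) :
  tens a (1 : 'Z_p) = 0 <-> exists a', a = a' *+ p.
Proof.
split=> [a0|[a' ->]]; last first.
  rewrite tensMnl pchar_Zp //; apply: (addrI (tens a' 0)).
  by rewrite -tensDr !addr0.
pose Q := Quotient.quot (@multiples A p).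
pose f (x : A) (b : 'Z_p) : Q := \pi_Q%qT x *+ b.
have Qp (x : A) : (\pi_Q%qT x : Q) *+ p = 0.
  rewrite -raddfMn -[RHS](raddf0 (\pi_Q%qT : A -> Q)) /=; apply/eqP.
  rewrite -Quotient.idealrBE subr0; apply/asboolP; by exists x.
have f_bi : biadditive f.
  split=> *; rewrite /f ?raddfD ?mulrnDl //=; exact: mulrn_Zp_add.
have /eqP := tensor_liftE f_bi a 1.
rewrite a0.
have -> : tensor_lift f 0 = 0.
  have := tensor_lift_zmod_morphism f_bi 0 0.
  by rewrite !subrr.
rewrite eq_sym /f.
have -> : nat_of_ord (1 : 'Z_p) = 1%N by [].
rewrite mulr1n -[X in _ == X](raddf0 (\pi_Q%qT : A -> Q)) /=.
by rewrite -Quotient.idealrBE subr0 => /asboolP.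
Qed.

End TensorZp.

Lemma additive_injective (U W : zmodType) (f : {additive U -> W}) :
  (forall u, f u = 0 -> u = 0) -> injective f.
Proof.
move=> f0 u v fuv; apply/eqP; rewrite -subr_eq0; apply/eqP/f0.
by rewrite raddfB fuv subrr.
Qed.

(** Both sides express that the map A / pA -> B / pB induced by [f] has trivial kernel. *)
Lemma tensor_Zp_injective (p : nat) (A B : zmodType) (f : {additive A -> B}) :
  (1 < p)%N ->
  injective (tensor_map f (idfun : {additive 'Z_p -> 'Z_p})) <->
  (forall a b, f a = b *+ p -> exists a', a = a' *+ p).
Proof.
move=> p_gt1; split=> [f_inj a b fab|fp].
  apply/(tens1_eq0 p_gt1)/f_inj; rewrite raddf0 [LHS]tensor_mapE fab.
  by apply/(tens1_eq0 p_gt1); exists b.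
apply: additive_injective => t; have [a ->] := tens1_surj t.
rewrite [X in X = _]tensor_mapE => /(tens1_eq0 p_gt1)[b /fp aA].
exact/(tens1_eq0 p_gt1).
Qed.

(** * Signs of oriented simplices under relabelling *)

Section PairSum.
Variables (T : Type) (h : T -> T -> bool).

Fixpoint pair_sum (s : seq T) : nat :=
  if s is x :: s' then (\sum_(y <- s') h x y + pair_sum s')%N else 0%N.

(** The full double sum counts every pair twice and gets nothing from the diagonal. It is visibly
    invariant under permutations of [s], which the recursive form is not. *)
Lemma pair_sum_double s : symmetric h -> (forall x, h x x = false) ->
  (pair_sum s).*2 = (\sum_(x <- s) \sum_(y <- s) h x y)%N.
Proof.
move=> h_sym hxx; elim: s => [|x s IHs] /=; first by rewrite big_nil.
rewrite doubleD IHs !big_cons hxx add0n.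
have -> : (\sum_(z <- s) \sum_(y <- x :: s) h z y =
    \sum_(z <- s) h x z + \sum_(z <- s) \sum_(y <- s) h z y)%N.
  by rewrite -big_split; apply: eq_bigr => z _; rewrite big_cons h_sym.
by rewrite addnA addnn.
Qed.

End PairSum.

Lemma perm_pair_sum (T : eqType) (h : T -> T -> bool) (s t : seq T) :
    symmetric h -> (forall x, h x x = false) ->
  perm_eq s t -> pair_sum h s = pair_sum h t.
Proof.
move=> h_sym hxx st; apply: double_inj; rewrite !pair_sum_double // (perm_big _ st).
by apply: eq_bigr => x _; apply: perm_big.
Qed.

Section Relabel.
Variables (E E' : finType) (f : E -> E').
Hypothesis f_inj : injective f.

(* The parity of [inversions (map f s) + inversions s] counts the pairs whose
   order [f] reverses, and so depends only on the set of entries of [s]. *)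
Definition order_flip (x y : E) : bool :=
  (enum_rank x < enum_rank y)%N (+) (enum_rank (f x) < enum_rank (f y))%N.

Lemma order_flipxx x : order_flip x x = false.
Proof. by rewrite /order_flip !ltnn. Qed.

Lemma order_flip_sym : symmetric order_flip.
Proof.
move=> x y; have [->//|xy] := eqVneq x y.
have rank_ltC (F : finType) (u v : F) : u != v ->
    (enum_rank v < enum_rank u)%N = ~~ (enum_rank u < enum_rank v)%N.
  move=> uv; rewrite -leqNgt ltn_neqAle andb_idl // => _; apply: contra uv.
  by move=> /eqP/val_inj/enum_rank_inj ->.
rewrite /order_flip [in RHS]rank_ltC // (rank_ltC _ (f x)) ?(inj_eq f_inj) //.
by rewrite addNb addbN negbK.
Qed.

Lemma odd_inversions_map s : odd (inversions [seq f x | x <- s]) =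
  odd (inversions s) (+) odd (pair_sum order_flip s).
Proof.
elim: s => //= x s IHs; rewrite !oddD IHs.
have -> : odd (\sum_(y <- s) order_flip x y) =
  odd (count (fun y => (enum_rank y < enum_rank x)%N) s) (+)
  odd (count (fun y => (enum_rank y < enum_rank (f x))%N) [seq f y | y <- s]).
  elim: s {IHs} => [|y s IHs] /=; first by rewrite big_nil.
  rewrite big_cons !oddD IHs order_flip_sym /order_flip !oddb.
  by do 2!case: (_ < _)%N => /=; do 2!case: odd.
by do 2!case: (odd (count _ _)); do 2!case: odd.
Qed.

Lemma odd_inversions_map_enum s : uniq s ->
  odd (inversions [seq f x | x <- s]) =
  odd (inversions s + inversions [seq f x | x <- enum [set x in s]]).
Proof.
move=> us; rewrite oddD !odd_inversions_map inversions_enum addFb.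
congr (_ (+) odd _).
apply: perm_pair_sum; [exact: order_flip_sym | exact: order_flipxx |].
by rewrite perm_sym perm_enum_set.
Qed.

(** The prefix [r] is empty when this is applied to [relabel], and consists of the apex when it is
    applied to [cone]. *)
Lemma osimplex_cat_map r s : uniq r -> uniq s ->
  osimplex (r ++ [seq f x | x <- s]) =
  osimplex (r ++ [seq f x | x <- enum [set x in s]]) *~ (-1) ^+ inversions s.
Proof.
move=> ur us.
rewrite osimplex_cat ?map_inj_uniq // [in RHS]osimplex_cat ?map_inj_uniq ?enum_uniq //.
have -> : [set x in [seq f x | x <- s]] =
          [set x in [seq f x | x <- enum [set x in s]]].
  by apply/setP=> x; rewrite !inE; apply: eq_mem_map => y; rewrite mem_enum inE.
rewrite -mulrzA -exprD -[in LHS]signr_odd -[in RHS]signr_odd.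
congr (_ *~ (_ ^+ nat_of_bool _)); rewrite -addnA oddD odd_inversions_map_enum //.
by rewrite -oddD [(inversions s + _)%N]addnC.
Qed.

Lemma relabel_osimplex s : relabel f (osimplex s) = osimplex (map f s).
Proof.
have [us|us] := boolP (uniq s); last by rewrite !osimplex_nuniq ?raddf0 ?map_inj_uniq.
by rewrite /relabel linear_ext_osimplex // -(@osimplex_cat_map [::]).
Qed.

End Relabel.

Lemma osimplex_val (E : finType) (s : seq E) U : uniq s ->
  osimplex s U = (-1) ^+ inversions s *+ (U == [set x in s]).
Proof. by move=> us; rewrite ffunE us /=; case: eqP. Qed.

Lemma chainE (E : finType) (c : chain E) :
  c = \sum_(S : {set E}) osimplex (enum S) *~ c S.
Proof.
apply/ffunP=> T; rewrite sum_ffunE (bigD1 T) //= chainMz osimplex_enum eqxx mul1r.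
rewrite big1 ?addr0 // => S ST.
by rewrite chainMz osimplex_enum eq_sym (negPf ST) mul0r.
Qed.

Lemma additive_chain_ext (E : finType) (V : zmodType) (f g : {additive chain E -> V}) :
  (forall S : {set E}, f (osimplex (enum S)) = g (osimplex (enum S))) -> f =1 g.
Proof.
move=> fg c; rewrite [c]chainE !raddf_sum; apply: eq_bigr => S _.
by rewrite !raddfMz fg.
Qed.

(** * Cones and links of chains *)

Section Avoiding.
Variables (E : finType) (e : E).

Definition avoiding : {pred chain E} :=
  [pred c : chain E | [forall U : {set E}, (e \in U) ==> (c U == 0)]].

Lemma avoidingP (c : chain E) :
  reflect (forall U : {set E}, e \in U -> c U = 0) (c \in avoiding).
Proof.
rewrite inE; apply: (iffP forallP) => [h U eU|h U]; first exact/eqP/(implyP (h U)).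
by apply/implyP => /h ->.
Qed.

Lemma avoiding_zmod_closed : zmod_closed avoiding.
Proof.
split=> [|u v /avoidingP ue /avoidingP ve]; apply/avoidingP => U eU.
  by rewrite ffunE.
by rewrite !ffunE ue ?ve ?subr0.
Qed.

HB.instance Definition _ :=
  GRing.isZmodClosed.Build (chain E) avoiding avoiding_zmod_closed.

Lemma osimplex_avoiding s : e \notin s -> osimplex s \in avoiding.
Proof.
move=> es; apply/avoidingP => U eU; rewrite ffunE; case: ifP => // /andP[_ /eqP UE].
by rewrite UE inE (negPf es) in eU.
Qed.

Lemma boundary_avoiding c : c \in avoiding -> boundary c \in avoiding.
Proof.
move=> /avoidingP ce; apply: rpred_sum => S _; have [eS|eS] := boolP (e \in S).
  by rewrite ce // mulr0z rpred0.
apply: rpredMz; apply: rpred_sum => i _; apply/rpredMz/osimplex_avoiding.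
apply: contra eS; rewrite -(mem_enum S) mem_cat => /orP[]; first exact: mem_take.
exact: mem_drop.
Qed.

End Avoiding.

Section Link.
Variables (E E' : finType) (phi : E -> E') (e : E').
Hypotheses (phi_inj : injective phi) (phi_e : forall x, phi x != e).

Definition cone : chain E -> chain E' :=
  linear_ext (fun s => osimplex (e :: [seq phi x | x <- s])).

HB.instance Definition _ := GRing.Additive.copy cone
  (linear_ext (fun s => osimplex (e :: [seq phi x | x <- s]))).

(* The adjoint of [cone]: the part of a chain supported on the simplices
   [e :: map phi t], with [e] removed from them and [phi] undone. *)
Definition link (c : chain E') : chain E :=
  [ffun T : {set E} => \sum_(U : {set E'})
     c U * osimplex (e :: [seq phi x | x <- enum T]) U].

Lemma link_zmod_morphism : zmod_morphism link.
Proof.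
move=> u v; apply/ffunP=> T; rewrite !ffunE -sumrB; apply: eq_bigr => U _.
by rewrite !ffunE mulrBl.
Qed.

HB.instance Definition _ := GRing.isZmodMorphism.Build
  (chain E') (chain E) link link_zmod_morphism.

Lemma cone_uniq s : uniq (e :: [seq phi x | x <- s]) = uniq s.
Proof.
rewrite /= map_inj_uniq // andb_idl // => _.
by apply/mapP => -[x _ ex]; have := phi_e x; rewrite -ex eqxx.
Qed.

Lemma osimplex_cone s : uniq s -> osimplex (e :: [seq phi x | x <- s]) =
  osimplex (e :: [seq phi x | x <- enum [set x in s]]) *~ (-1) ^+ inversions s.
Proof. by move=> us; rewrite -cat1s osimplex_cat_map. Qed.

Lemma cone_osimplex s : cone (osimplex s) = osimplex (e :: [seq phi x | x <- s]).
Proof.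
have [us|us] := boolP (uniq s); last by rewrite !osimplex_nuniq ?raddf0 ?cone_uniq.
by rewrite /cone linear_ext_osimplex // -osimplex_cone.
Qed.

Lemma set_cone (T : {set E}) :
  [set x in e :: [seq phi x | x <- enum T]] = e |: phi @: T.
Proof.
apply/setP=> x; rewrite !inE; congr (_ || _).
by apply/mapP/imsetP => -[y yT ->]; exists y => //; rewrite mem_enum in yT *.
Qed.

Lemma set_cone_inj (T T' : {set E}) :
  (e |: phi @: T == e |: phi @: T') = (T == T').
Proof.
apply/eqP/eqP => [TT'|-> //]; apply: (imset_inj phi_inj).
have e_phi (A : {set E}) : e \notin phi @: A.
  by apply/imsetP => -[x _ ex]; have := phi_e x; rewrite -ex eqxx.
by rewrite -(setU1K (e_phi T)) TT' setU1K.
Qed.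

(** Once [s] is an enumeration, the coefficient at [T] pairs two oriented simplices: with distinct
    supports they are orthogonal, and a simplex paired with itself gives the square of a sign. *)
Lemma link_osimplex s : link (osimplex (e :: [seq phi x | x <- s])) = osimplex s.
Proof.
have [us|us] := boolP (uniq s); last first.
  by rewrite !osimplex_nuniq ?raddf0 // cone_uniq.
rewrite osimplex_cone // raddfMz /= [RHS]osimplexE //; congr (_ *~ _).
move: [set x in s] => S; apply/ffunP=> T; rewrite osimplex_enum ffunE.
rewrite (bigD1 (e |: phi @: S)) //= big1 ?addr0 => [|U US].
  rewrite !osimplex_val ?cone_uniq ?enum_uniq // !set_cone eqxx set_cone_inj eq_sym.
  by case: eqP => [->|_]; rewrite ?mulr0 // !mulr1n -expr2 sqrr_sign.
by rewrite osimplex_val ?cone_uniq ?enum_uniq // set_cone (negPf US) mul0r.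
Qed.

Lemma link_avoiding c : c \in avoiding e -> link c = 0.
Proof.
move=> /avoidingP ce; apply/ffunP=> T; rewrite !ffunE big1 // => U _.
have [eU|eU] := boolP (e \in U); first by rewrite ce ?mul0r.
rewrite osimplex_val ?cone_uniq ?enum_uniq // set_cone; case: eqP; rewrite ?mulr0 //.
by move=> UE; rewrite UE setU11 in eU.
Qed.

Lemma coneK a : link (cone a) = a.
Proof.
rewrite [LHS]raddf_sum [RHS]chainE; apply: eq_bigr => S _.
by rewrite raddfMz /= link_osimplex.
Qed.

(** Deleting the apex leaves the base; for every other deletion the apex in front raises the index
    by one, whence the minus sign. *)
Lemma boundary_cone a : boundary (cone a) = relabel phi a - cone (boundary a).
Proof.
pose f : {additive chain E -> chain E'} := @boundary E' \o cone.
pose g : {additive chain E -> chain E'} := relabel phi \- (cone \o @boundary E).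
apply: (@additive_chain_ext _ _ f g) => S; rewrite {}/f {}/g /=.
have uS := enum_uniq (mem S).
rewrite cone_osimplex // relabel_osimplex // !boundary_osimplex ?cone_uniq //.
rewrite /osimplex_boundary /= big_ord_recl /= drop0 expr0 mulr1z; congr (_ + _).
rewrite [cone _](raddf_sum cone) -sumrN size_map; apply: eq_bigr => i _ /=.
rewrite exprS mulN1r mulrNz [cone _](raddfMz cone) /=; congr (- (_ *~ _)).
by rewrite -map_take -map_drop -map_cat cone_osimplex.
Qed.

Lemma relabel_avoiding a : relabel phi a \in avoiding e.
Proof.
apply: rpred_sum => S _; apply/rpredMz/osimplex_avoiding.
by apply/mapP => -[x _ ex]; have := phi_e x; rewrite -ex eqxx.
Qed.

Lemma link_boundary_cone a : link (boundary (cone a)) = - boundary a.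
Proof.
by rewrite boundary_cone raddfB /= coneK link_avoiding ?relabel_avoiding ?sub0r.
Qed.

Variable K : complex E'.
Hypothesis K_link : forall S, S \in faces K -> e \in S ->
  forall x, x \in S -> x != e -> exists y, x = phi y.

Lemma cone_link_face S : S \in faces K -> e \in S ->
  exists T : {set E}, S = e |: phi @: T.
Proof.
move=> SK eS; exists (phi @^-1: S); apply/setP => x; rewrite !inE.
have [->|xe] := eqVneq x e; first by rewrite eS.
apply/idP/imsetP => [xS|[y]]; last by rewrite inE => yS ->.
by have [y xy] := K_link SK eS xS xe; exists y; rewrite // inE -xy.
Qed.

(** It suffices to treat single faces: one without [e] has zero link, and one with [e] is up to sign
    a cone, by [cone_link_face], so it is restored by [cone] from its link. *)
Lemma cone_link q c : c \in chain_on K q -> c - cone (link c) \in avoiding e.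
Proof.
pose f : {additive chain E' -> chain E'} := idfun \- (cone \o link).
move=> /chain_onP cK; rewrite -[X in X \in _]/(f c) (chainE c) raddf_sum.
apply: rpred_sum => S _; rewrite raddfMz /=.
have [->|/cK[SK _]] := eqVneq (c S) 0; first by rewrite mulr0z rpred0.
apply: rpredMz; rewrite {}/f /=.
have [eS|eS] := boolP (e \in S); last first.
  have aS : osimplex (enum S) \in avoiding e by rewrite osimplex_avoiding ?mem_enum.
  by rewrite (link_avoiding aS) raddf0 subr0.
have [T ST] := cone_link_face SK eS.
have uT : uniq (e :: [seq phi x | x <- enum T]) by rewrite cone_uniq enum_uniq.
have -> : osimplex (enum S) = osimplex (e :: [seq phi x | x <- enum T]) *~
    (-1) ^+ inversions (e :: [seq phi x | x <- enum T]).
  by rewrite [in RHS]osimplexE // -mulrzA -expr2 sqrr_sign set_cone -ST.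
rewrite (raddfMz link) /= link_osimplex (raddfMz cone) /=.
by rewrite cone_osimplex // subrr rpred0.
Qed.

(** Split [c] by [cone_link]. The boundary of the part avoiding [e] still avoids [e] and has zero
    link, so only the cone contributes. *)
Lemma link_boundary q c : c \in chain_on K q -> link (boundary c) = - boundary (link c).
Proof.
move=> /cone_link cK.
rewrite -[c in LHS](subrK (cone (link c))) raddfD raddfD /= link_boundary_cone.
by rewrite link_avoiding ?add0r ?boundary_avoiding.
Qed.

Variable L : complex E.
Hypothesis link_face : forall T : {set E}, e |: phi @: T \in faces K -> T \in faces L.

Lemma link_chain_on q c : c \in chain_on K q.+1 -> link c \in chain_on L q.
Proof.
move=> /chain_onP cK; apply/chain_onP => T; rewrite ffunE.
rewrite (bigD1 (e |: phi @: T)) //= big1 ?addr0; last first.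
  move=> U UT; rewrite osimplex_val ?cone_uniq ?enum_uniq // set_cone.
  by rewrite (negPf UT) mulr0.
rewrite mulf_eq0 negb_or => /andP[/cK[TK Tq] _]; split; first exact: link_face.
move: Tq; rewrite cardsU1 card_imset // => /eqP.
have -> : e \notin phi @: T.
  by apply/imsetP => -[x _ ex]; have := phi_e x; rewrite -ex eqxx.
by rewrite add1n eqSS => /eqP.
Qed.

Lemma link_cycle_on q c : c \in cycle_on K q.+1 -> link c \in cycle_on L q.
Proof.
case/andP=> cK /eqP bc; apply/andP; split; first exact: link_chain_on.
by rewrite -[boundary _]opprK -(link_boundary cK) bc raddf0 oppr0.
Qed.

End Link.

(** * The link of an edge in a matching complex *)

Section MatchingLink.
Variables (V W : finType) (G : sgraph V) (H : sgraph W) (g : V -> W) (a b : W).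
Hypotheses (g_inj : injective g) (g_adj : forall x y, adj H (g x) (g y) = adj G x y).
Hypothesis g_img : forall w, (w \in codom g) = (w \notin [set a; b]).

Let phi (x : {set V}) : {set W} := g @: x.

Lemma imset_neq_edge (x : {set V}) : g @: x != [set a; b].
Proof.
apply/eqP => xab; have : a \in g @: x by rewrite xab set21.
by case/imsetP => v _ av; have := g_img a; rewrite set21 {1}av codom_f.
Qed.

Lemma imset_edge (x : {set V}) : g @: x \in edges H -> x \in edges G.
Proof.
case/imsetP => -[u v]; rewrite !inE /= => uv xuv.
have /imsetP[u' u'x uE] : u \in g @: x by rewrite xuv set21.
have /imsetP[v' v'x vE] : v \in g @: x by rewrite xuv set22.
apply/imsetP; exists (u', v'); first by rewrite inE /= -g_adj -uE -vE.
by apply: (imset_inj g_inj); rewrite xuv uE vE imsetU !imset_set1.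
Qed.

Lemma matching_cone_face (T : {set {set V}}) :
  [set a; b] |: phi @: T \in faces (matching_complex H) ->
  T \in faces (matching_complex G).
Proof.
rewrite !inE => /andP[/subsetP TH /trivIsetP trT]; apply/andP; split.
  by apply/subsetP => x xT; apply/imset_edge/TH; rewrite setU1r // imset_f.
apply/trivIsetP => x y xT yT xy.
have : [disjoint phi x & phi y].
  by apply: trT; rewrite ?setU1r ?imset_f // (inj_eq (imset_inj g_inj)).
by rewrite -!setI_eq0 -imsetI ?imset_eq0 // => ? ? _ _ /g_inj.
Qed.

(** The other edges of the matching are disjoint from the edge ab, so all their vertices lie in the
    image of [g]. *)
Lemma matching_link S : S \in faces (matching_complex H) -> [set a; b] \in S ->
  forall x, x \in S -> x != [set a; b] -> exists y, x = phi y.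
Proof.
rewrite inE => /andP[_ /trivIsetP trS] abS x xS xab.
exists (g @^-1: x); apply/setP => w; apply/idP/imsetP => [wx|[v]]; last first.
  by rewrite inE => vx ->.
have : w \in codom g.
  rewrite g_img; apply: contraL wx => wab.
  by rewrite (disjointFl (trS _ _ xS abS xab)).
by case/codomP => v wv; exists v; rewrite // inE -wv.
Qed.

End MatchingLink.

(** * Links commute with joining a fixed chain *)

Section JoinLink.
Variables (m m' n : nat) (g : 'I_m -> 'I_m') (a b : 'I_m').
Hypotheses (g_inj : injective g).
Hypothesis g_img : forall w, (w \in codom g) = (w \notin [set a; b]).

(** The image misses exactly the copies of [a] and [b], so the link of their edge in the larger
    complete graph is indexed by matchings on m + n vertices. *)
Definition extend_id (i : 'I_(m + n)) : 'I_(m' + n) :=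
  match split i with inl j => lshift n (g j) | inr j => rshift m' j end.

Lemma extend_id_lshift i : extend_id (lshift n i) = lshift n (g i).
Proof. by rewrite /extend_id (unsplitK (inl i)). Qed.

Lemma extend_id_rshift j : extend_id (rshift m j) = rshift m' j.
Proof. by rewrite /extend_id (unsplitK (inr j)). Qed.

Lemma extend_id_inj : injective extend_id.
Proof.
move=> i j; rewrite -[i]splitK -[j]splitK; case: (split i) (split j) => u [] v /=;
  rewrite ?extend_id_lshift ?extend_id_rshift.
- by move/lshift_inj/g_inj ->.
- by move/eqP; rewrite eq_lrshift.
- by move/eqP; rewrite eq_rlshift.
- by move/rshift_inj ->.
Qed.

Lemma extend_id_img w :
  (w \in codom extend_id) = (w \notin [set lshift n a; lshift n b]).
Proof.
rewrite -[w]splitK; case: (split w) => u /=; last first.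
  by rewrite -extend_id_rshift codom_f !inE !extend_id_rshift !eq_rlshift.
rewrite !inE !(inj_eq (@lshift_inj _ _)); have := g_img u; rewrite !inE => <-.
apply/codomP/codomP => [[i]|[i ->]]; last first.
  by exists (lshift n i); rewrite extend_id_lshift.
rewrite -[i]splitK; case: (split i) => v /=.
  by rewrite extend_id_lshift => /lshift_inj ->; exists v.
by rewrite extend_id_rshift => /eqP; rewrite eq_lrshift.
Qed.

Let phi (x : {set 'I_m}) : {set 'I_m'} := g @: x.
Let psi (x : {set 'I_(m + n)}) : {set 'I_(m' + n)} := extend_id @: x.

Lemma imset_edge_inl x : psi (edge_inl n x) = edge_inl n (phi x).
Proof.
rewrite /psi /phi /edge_inl -!imset_comp; apply: eq_imset => i /=.
exact: extend_id_lshift.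
Qed.

Lemma imset_edge_shift x : psi (edge_shift m x) = edge_shift m' x.
Proof.
rewrite /psi /edge_shift -imset_comp; apply: eq_imset => i /=.
exact: extend_id_rshift.
Qed.

Lemma edge_inl_set2 : edge_inl n [set a; b] = [set lshift n a; lshift n b].
Proof. by rewrite /edge_inl imsetU !imset_set1. Qed.

Local Notation e := [set a; b].
Local Notation e' := [set lshift n a; lshift n b].

(** The apex stands in front of the left factor, hence in front of the whole join, and no sign
    appears. *)
Lemma cone_join z c : cone psi e' (join z c) = join (cone phi e z) c.
Proof.
have psi_inj : injective psi by apply/imset_inj/extend_id_inj.
have psi_e' x : psi x != e' by apply/imset_neq_edge/extend_id_img.
have relabel_cone : relabel (@edge_inl m' n) (cone phi e z) =
    \sum_(S : {set {set 'I_m}})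
      osimplex [seq edge_inl n x | x <- e :: [seq phi x | x <- enum S]] *~ z S.
  rewrite /cone {1}/linear_ext (raddf_sum (relabel _)); apply: eq_bigr => S _.
  by rewrite (raddfMz (relabel _)) [X in X *~ _]relabel_osimplex //; exact: edge_inl_inj.
rewrite joinE (raddf_sum (cone psi e')) /join relabel_cone wedge_suml.
apply: eq_bigr => S _; rewrite (raddf_sum (cone psi e')) wedgeMzl.
rewrite {1}/relabel {1}/linear_ext raddf_sum mulrz_suml.
apply: eq_bigr => T _; rewrite (raddfMz (cone psi e')) raddfMz -mulrzA [c T * _]mulrC.
congr (_ *~ _); rewrite /= cone_osimplex // wedge_osimplex; first 1 last.
- rewrite (map_inj_uniq (@edge_inl_inj m' n) (e :: _)) cone_uniq ?enum_uniq //.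
    exact: imset_inj g_inj.
  by move=> x; apply: imset_neq_edge.
- by rewrite map_inj_uniq ?enum_uniq //; exact: edge_shift_inj.
rewrite /join_seq map_cat -!map_comp /= edge_inl_set2; congr (osimplex (_ :: _ ++ _)).
  by apply: eq_map => x /=; rewrite imset_edge_inl.
by apply: eq_map => x /=; rewrite imset_edge_shift.
Qed.

Lemma join_avoiding z c : z \in avoiding e -> join z c \in avoiding e'.
Proof.
move=> /avoidingP ze; rewrite joinE.
apply: rpred_sum => S _; apply: rpred_sum => T _.
have [eS|eS] := boolP (e \in S); first by rewrite ze // mul0r mulr0z rpred0.
apply/rpredMz/osimplex_avoiding; rewrite mem_cat -edge_inl_set2.
rewrite (mem_map (@edge_inl_inj m' n)) mem_enum (negPf eS) /=.
(* A shifted edge equal to the copy of [e] would be disjoint from itself, although it contains the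
   copy of [a]. *)
apply/mapP => -[y _ ey]; have := edge_inl_shift_disjoint e y.
rewrite -ey -setI_eq0 setIid => /eqP/setP/(_ (lshift n a)).
by rewrite inE imset_f // set21.
Qed.

(** Split [z] by [cone_link]: the cone part is handled by [cone_join] and [coneK], and the remainder
    still avoids the edge after joining, so its link is zero. *)
Lemma link_join (H : sgraph 'I_m') q z c : z \in chain_on (matching_complex H) q ->
  link psi e' (join z c) = join (link phi e z) c.
Proof.
have phi_inj : injective phi by exact: imset_inj.
have phi_e x : phi x != e by exact: imset_neq_edge.
have psi_inj : injective psi by apply/imset_inj/extend_id_inj.
have psi_e' x : psi x != e' by apply/imset_neq_edge/extend_id_img.
move=> zH; have K_link := @matching_link _ _ H g a b g_img.
have ze := cone_link phi_inj phi_e K_link zH.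
rewrite -{1}[z](subrK (cone phi e (link phi e z))).
have joinD u v : join (u + v) c = join u c + join v c :> chain {set 'I_(m' + n)}.
  by rewrite -[u in RHS](addrK v) [in RHS](join_zmod_morphisml c (u + v) v) subrK.
rewrite joinD -cone_join (raddfD (link psi e')) /= coneK // link_avoiding ?add0r //.
exact: join_avoiding.
Qed.

End JoinLink.

(** * Coefficients of top-dimensional cycles of matchings *)

Section PrimeCycles.
Variables (V : finType) (G : sgraph V) (v0 : V) (k : nat).
Hypothesis V_card : #|V| = k.*2.+1.

Lemma card_edge x : x \in edges G -> #|x| = 2%N.
Proof.
case/imsetP => -[u v]; rewrite inE /= => uv ->; rewrite cards2.
by case: eqP uv => // ->; rewrite adj_irrefl.
Qed.

Lemma card_cover_matching S : S \in faces (matching_complex G) ->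
  #|cover S| = (#|S|.*2)%N.
Proof.
rewrite inE => /andP[/subsetP SG /eqP <-]; rewrite -muln2 -sum_nat_const.
by apply: eq_bigr => x xS; rewrite card_edge ?SG.
Qed.

Lemma matching_card S : S \in faces (matching_complex G) -> (#|S| <= k)%N.
Proof.
move=> /card_cover_matching SE; rewrite -[#|S|]doubleK -(half_bit_double k true).
(* With [k] written as the half of 2k + 1, the bound says that the covered vertices number at most
   2k + 1. *)
by rewrite half_leq // -SE add1n -V_card max_card.
Qed.

Lemma cover_matching_avoiding S : S \in faces (matching_complex G) -> #|S| = k ->
  v0 \notin cover S -> cover S = [set~ v0].
Proof.
move=> SG Sk v0S; apply/eqP; rewrite eqEcard card_cover_matching // Sk.
rewrite cardsC1 V_card leqnn andbT; apply/subsetP => v vS; rewrite !inE.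
by apply: contraNneq v0S => <-.
Qed.

Lemma cover_setD1 S x : S \in faces (matching_complex G) -> x \in S ->
  cover (S :\ x) = cover S :\: x.
Proof.
rewrite inE => /andP[_ /trivIsetP trS] xS; apply/setP => v; rewrite inE.
apply/bigcupP/andP => [[y]|[vx /bigcupP[y yS vy]]]; last first.
  by exists y; rewrite // !inE yS andbT; apply: contraNneq vx => <-.
rewrite !inE => /andP[yx yS] vy; split; last by apply/bigcupP; exists y.
by rewrite (disjointFr (trS _ _ yS xS yx)).
Qed.

Lemma osimplex_boundary_enum (S T : {set {set V}}) :
  osimplex_boundary (enum S) T =
    \sum_(x <- enum S) (osimplex (rem x (enum S)) T * (-1) ^+ index x (enum S)).
Proof.
rewrite osimplex_boundaryE ?enum_uniq // sum_ffunE.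
by apply: eq_bigr => x _; rewrite chainMz.
Qed.

Lemma set_rem_enum (S : {set {set V}}) x : [set y in rem x (enum S)] = S :\ x.
Proof. by apply/setP => y; rewrite !inE mem_rem_uniq ?enum_uniq // !inE mem_enum. Qed.

(** Only the deletion of [x] produces this facet, so its coefficient is a single sign. *)
Lemma osimplex_boundary_facet (S : {set {set V}}) x : x \in S ->
  osimplex_boundary (enum S) (S :\ x) \is a GRing.unit.
Proof.
move=> xS; rewrite osimplex_boundary_enum (bigD1_seq x) ?enum_uniq ?mem_enum //=.
rewrite big1_seq ?addr0 => [|y /andP[yx yS]].
  rewrite osimplex_val ?rem_uniq ?enum_uniq // set_rem_enum eqxx -exprD.
  by rewrite unitrX ?unitrN1.
rewrite osimplex_val ?rem_uniq ?enum_uniq // set_rem_enum.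
case: eqP => [/setP/(_ y)|_]; last by rewrite mul0r.
by rewrite !inE eqxx yx -mem_enum yS.
Qed.

Lemma osimplex_boundary_neq0 (U T : {set {set V}}) :
  osimplex_boundary (enum U) T != 0 -> exists2 x, x \in U & T = U :\ x.
Proof.
move=> T0; have [/existsP[x /andP[xU /eqP]]|nT] :=
    boolP [exists x, (x \in U) && (T == U :\ x)].
  by exists x.
case/eqP: T0; rewrite osimplex_boundary_enum big1_seq // => x /= xU.
rewrite osimplex_val ?rem_uniq ?enum_uniq // set_rem_enum.
case: eqP => TU; last by rewrite mul0r.
by case/existsP: nT; exists x; rewrite -mem_enum xU TU eqxx.
Qed.

(** The deleted edge is recovered as the set of vertices that the matching covers and its facet does
    not; with equal covers and equal facets, the deleted edges agree. *)
Lemma matching_facet_inj S U x y :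
    S \in faces (matching_complex G) -> U \in faces (matching_complex G) ->
    cover S = cover U -> x \in S -> y \in U -> S :\ x = U :\ y ->
  U = S.
Proof.
move=> SG UG SU xS yU xy; have : cover S :\: x = cover U :\: y.
  by rewrite -!cover_setD1 // xy.
have sub_cover (A : {set {set V}}) z : z \in A -> z \subset cover A.
  by move=> zA; apply: bigcup_sup zA.
have setDK (A B : {set V}) : A \subset B -> B :\: (B :\: A) = A.
  by move=> AB; rewrite setDDr setDv set0U; apply/setIidPr.
rewrite SU => exy; have {exy} exy : x = y.
  have xU : x \subset cover U by rewrite -SU sub_cover.
  by rewrite -(setDK _ _ xU) exy setDK ?sub_cover.
by rewrite -(setD1K xS) xy exy setD1K.
Qed.

(* A matching of size k which avoids v0 covers all other vertices, so if e is
   one of its edges, then the boundary at S :\ e only sees S and matchings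
   that cover v0. *)
Lemma cycle_dvd (p : int) (z : chain {set V}) : z \in cycle_on (matching_complex G) k ->
    (forall S, v0 \in cover S -> (p %| z S)%Z) ->
  (0 < k)%N -> forall S, (p %| z S)%Z.
Proof.
case/andP=> /chain_onP zk /eqP bz zp k_gt0 S.
have [v0S|v0S] := boolP (v0 \in cover S); first exact: zp.
have [->|/zk[SG Sk]] := eqVneq (z S) 0; first exact: dvdz0.
have /set0Pn[e eS] : S != set0 by rewrite -card_gt0 Sk.
have : boundary z (S :\ e) = 0 by rewrite bz ffunE.
rewrite /boundary /linear_ext sum_ffunE (bigD1 S) //= => /eqP.
rewrite chainMz addr_eq0 => /eqP zS.
(* The coefficient of the facet is invertible, so it is enough that [p] divides all the other terms
   of the boundary there. *)
rewrite -(mulKr (osimplex_boundary_facet eS) (z S)) dvdz_mull // zS rpredN.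
apply: rpred_sum => U US; rewrite chainMz.
have [v0U|v0U] := boolP (v0 \in cover U); first by rewrite dvdz_mull ?zp.
have [->|/zk[UG Uk]] := eqVneq (z U) 0; first by rewrite mulr0 dvdz0.
have [->|/osimplex_boundary_neq0[x xU SU]] :=
  eqVneq (osimplex_boundary (enum U) (S :\ e)) 0; first by rewrite mul0r dvdz0.
case/eqP: US; apply: (matching_facet_inj SG UG _ eS xU SU).
by rewrite (cover_matching_avoiding SG Sk v0S) (cover_matching_avoiding UG Uk v0U).
Qed.

End PrimeCycles.

(** * Divisibility along the compatible family *)

Lemma cone_dvd (E E' : finType) (phi : E -> E') (e : E') (p : int) (c : chain E) U :
  (forall T, (p %| c T)%Z) -> (p %| cone phi e c U)%Z.
Proof.
move=> cp; rewrite /cone /linear_ext sum_ffunE; apply: rpred_sum => S _.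
by rewrite chainMz dvdz_mull.
Qed.

Lemma homology_class_surj (E : finType) (K : complex E) k (h : homology K k) :
  exists z, h = homology_class z.
Proof. by exists (repr h); rewrite /homology_class reprK. Qed.

(** The injectivity condition at the level of chains, where links can be applied to each term;
    [theta_dvdP] relates it to homology. *)
Definition join_reflects_dvd m (G : sgraph 'I_m) (n k d p : nat)
    (gamma : chain {set 'I_n}) : Prop :=
  forall z w b, z \in cycle_on (matching_complex G) k ->
    w \in cycle_on (matching_complex (complete_graph (m + n))) (k + d) ->
    b \in chain_on (matching_complex (complete_graph (m + n))) (k + d).+1 ->
    join z gamma = w *+ p + boundary b -> forall S, (p %| z S)%Z.

Lemma join_reflects_dvdS k (G : sgraph 'I_(k.*2.+1)) (H : sgraph 'I_(k.+1.*2.+1))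
    (n d p : nat) (gamma : chain {set 'I_n}) :
    (forall s, adj H ord0 s ->
       graph_isomorphic (induced H (~: [set ord0; s])) G) ->
  join_reflects_dvd G k d p gamma -> join_reflects_dvd H k.+1 d p gamma.
Proof.
move=> HG Gdvd z w b zH wK bK zwb.
(* Only the matchings that cover vertex 1 remain to be treated. *)
apply: (@cycle_dvd _ H ord0 k.+1 (card_ord _) _ _ zH) => //.
move=> S /bigcupP[x xS x0]; have [->|zS] := eqVneq (z S) 0; first exact: dvdz0.
have zk : z \in chain_on (matching_complex H) k.+1 by case/andP: zH.
have [SH _] := chain_onP _ _ _ zk S zS.
have {x0} [s Hs xE] : exists2 s, adj H ord0 s & x = [set ord0; s].
  move: SH; rewrite inE => /andP[/subsetP/(_ x xS)/imsetP[[u v]] + + _].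
  rewrite inE /= => Huv xE; move: x0; rewrite xE !inE => /orP[] /eqP ->.
    by exists v.
  by exists u; [rewrite adj_sym | rewrite setUC].
rewrite {}xE in xS; have [f f_bij fadj] := HG s Hs; have [f' f'K fK] := f_bij.
(* The inverse of the isomorphism embeds [G] in [H] with image all vertices except 1 and [s]. *)
pose g i := val (f' i).
have g_inj : injective g by move=> i j /val_inj/(can_inj fK).
have g_adj i j : adj H (g i) (g j) = adj G i j.
  by rewrite -[in RHS](fK i) -[in RHS](fK j) fadj.
have g_img u : (u \in codom g) = (u \notin [set ord0; s]).
  rewrite -in_setC; apply/codomP/idP => [[i ->]|us]; first exact: valP.
  by exists (f (Sub u us)); rewrite /g f'K.
set e := [set ord0; s] in xS g_img.
set phi := fun x : {set 'I_(k.*2.+1)} => g @: x.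
have phi_inj : injective phi by exact: imset_inj.
have phi_e y : phi y != e by exact: imset_neq_edge.
set psi := fun x : {set 'I_(k.*2.+1 + n)} => extend_id g @: x.
have psi_inj : injective psi by apply/imset_inj/extend_id_inj.
have psi_img := @extend_id_img _ _ n _ _ _ g_img.
set e' := [set lshift n ord0; lshift n s] in psi_img.
have psi_e' y : psi y != e' by exact: imset_neq_edge.
have psi_adj i j : adj (complete_graph (k.+1.*2.+1 + n)) (extend_id g i) (extend_id g j) =
    adj (complete_graph (k.*2.+1 + n)) i j.
  by rewrite /= (inj_eq (extend_id_inj g_inj)).
have phi_link := @matching_link _ _ H g ord0 s g_img.
have psi_link := @matching_link _ _ (complete_graph (k.+1.*2.+1 + n)) _ _ _ psi_img.
have phi_face := @matching_cone_face _ _ G H g ord0 s g_inj g_adj.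
have psi_face := @matching_cone_face _ _ (complete_graph (k.*2.+1 + n)) _ _
  (lshift n ord0) (lshift n s)
  (extend_id_inj g_inj) psi_adj.
have lz : forall T, (p %| link phi e z T)%Z.
  (* The link anticommutes with the boundary, so the filling [b] is replaced by the negative of its
     link. *)
  apply: (Gdvd (link phi e z) (link psi e' w) (- link psi e' b)).
  - exact: (link_cycle_on phi_inj phi_e phi_link phi_face zH).
  - exact: (link_cycle_on psi_inj psi_e' psi_link psi_face wK).
  - by rewrite rpredN; exact: (link_chain_on psi_inj psi_e' psi_face bK).
  rewrite -(link_join g_inj g_img _ zk) zwb raddfD raddfMn /=.
  by rewrite (link_boundary psi_inj psi_e' psi_link bK) (raddfN (@boundary _)).
(* As [S] contains the edge [e], its coefficient in [z] is the one in the cone over the link of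
   [z]. *)
have := cone_link phi_inj phi_e phi_link zk => /avoidingP/(_ S xS).
rewrite !ffunE => /eqP; rewrite subr_eq0 => /eqP ->.
exact: cone_dvd.
Qed.

(** * From chains to homology classes *)

Section ThetaDvd.
Variables (k n d p : nat) (G : sgraph 'I_(k.*2.+1)).
Variable gamma : zcycle (matching_complex (complete_graph n)) d.
Hypothesis p_gt0 : (0 < p)%N.

Lemma chain_on_top0 b : b \in chain_on (matching_complex G) k.+1 -> b = 0.
Proof.
move=> /chain_onP bk; apply/ffunP => S; rewrite ffunE; apply/eqP.
apply/negPn/negP => /bk[SG Sk].
by have := matching_card (card_ord _) SG; rewrite Sk ltnn.
Qed.

(** A matching on 2k + 1 vertices has at most k edges, so there is nothing to bound in index [k] and
    homology is the group of cycles itself. *)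
Lemma homology_class_inj : injective (@homology_class _ (matching_complex G) k).
Proof.
apply: additive_injective => z /homology_class_eq0[b /chain_on_top0 -> zb].
by apply: val_inj; rewrite /= zb raddf0.
Qed.

(** The integers have no torsion, so the coefficientwise quotient by [p] still has zero boundary. *)
Lemma cycle_divisible (z : zcycle (matching_complex G) k) :
  (forall S, (p %| cycle_val z S)%Z) -> exists z', z = z' *+ p.
Proof.
move=> zp; pose c : chain {set 'I_(k.*2.+1)} := [ffun S => (cycle_val z S %/ p)%Z].
have zc : cycle_val z = c *+ p.
  by apply/ffunP => S; rewrite ffunMnE ffunE -mulr_natr natz divzK.
have cP : c \in cycle_on (matching_complex G) k.
  have /andP[/chain_onP zk /eqP bz] := cycleP z; apply/andP; split.
    apply/chain_onP => S cS; apply: zk; rewrite zc ffunMnE mulrn_eq0 negb_or.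
    by rewrite cS -lt0n p_gt0.
  apply/eqP/ffunP => S; have /ffunP/(_ S) := bz; rewrite zc raddfMn ffunMnE ffunE.
  by move/eqP; rewrite mulrn_eq0 eqn0Ngt p_gt0 /= => /eqP.
by exists (Cycle cP); apply: val_inj; rewrite /= zc raddfMn.
Qed.

(** An equality of classes in the target is an equality of cycles up to a boundary. In the source
    classes are cycles, so divisibility of a class can be tested on coefficients. *)
Lemma theta_dvdP :
  (forall h h', theta G k gamma h = h' *+ p -> exists h'', h = h'' *+ p) <->
  join_reflects_dvd G k d p gamma.
Proof.
split=> [h_dvd z w b zP wP bK zwb S|z_dvd h h'].
  have [|h] := h_dvd (homology_class (Cycle zP)) (homology_class (Cycle wP)).
    rewrite thetaE -raddfMn; apply/eqP; rewrite -subr_eq0 -raddfB; apply/eqP.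
    apply/homology_class_eq0; exists b => //.
    by rewrite raddfB raddfMn /= zwb addrAC subrr add0r.
  have [z' ->] := homology_class_surj h.
  rewrite -raddfMn => /homology_class_inj/(congr1 (@cycle_val _ _ _)) /= ->.
  by rewrite raddfMn /= ffunMnE -mulr_natr natz dvdz_mull.
have [z ->] := homology_class_surj h; have [w ->] := homology_class_surj h'.
rewrite thetaE -raddfMn => /eqP; rewrite -subr_eq0 -raddfB => /eqP.
case/homology_class_eq0 => b bK /eqP; rewrite raddfB raddfMn /= subr_eq addrC => /eqP zwb.
have [|z' ->] := @cycle_divisible z.
  exact: (z_dvd z w b (cycleP z) (cycleP w) bK zwb).
by exists (homology_class z'); rewrite raddfMn.
Qed.

End ThetaDvd.

(** * Multiples by residues, and families independent modulo p *)

Section ModularMultiples.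
Variables (p : nat) (p_gt1 : (1 < p)%N) (A : zmodType) (x : A).
Hypothesis xp : x *+ p = 0.

Lemma mulrn_Zp_nat n : x *+ (n%:R : 'Z_p)%R = x *+ n.
Proof.
by rewrite [in RHS](divn_eq n p) mulrnDr mulnC mulrnA xp mul0rn add0r val_Zp_nat.
Qed.

Lemma mulrn_Zp_int (a : int) : x *+ (a%:~R : 'Z_p)%R = x *~ a.
Proof.
case: a => n; first exact: mulrn_Zp_nat.
rewrite NegzE mulrNz; apply/eqP; rewrite -subr_eq0 opprK.
rewrite -pmulrn -(mulrn_Zp_nat n.+1).
by rewrite -mulrn_Zp_add // addNr mulr0n.
Qed.

End ModularMultiples.

Lemma cycle_saturated (E : finType) (K : complex E) k (c : chain E) (d : int) :
  d != 0 -> c *~ d \in cycle_on K k -> c \in cycle_on K k.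
Proof.
move=> d0 /andP[/chain_onP cdk /eqP bcd]; apply/andP; split.
  by apply/chain_onP => S cS; apply: cdk; rewrite chainMz mulf_neq0.
apply/eqP/ffunP => S; have /ffunP/(_ S) := bcd; rewrite raddfMz /= chainMz ffunE.
by move/eqP; rewrite mulf_eq0 (negPf d0) orbF => /eqP.
Qed.

Section UnimodularBasis.
Variables (E : finType) (K : complex E) (k r : nat).
Hypothesis class_inj : injective (@homology_class _ K k).
Variable a : 'I_r -> homology K k.
Hypothesis a_ind : independent a.

(** The family [a] itself may become dependent modulo [p]. The Smith form M = L D R of its
    coordinate matrix replaces it by the first [r] rows of the unimodular R, which are part of a
    basis of the chains. They are cycles because their multiples by the invariant factors are
    integral combinations of the given cycles. *)
Lemma independent_mod : exists y : 'I_r -> homology K k,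
  forall (p : nat) (c : 'I_r -> int) h, \sum_i y i *~ c i = h *+ p ->
  forall i, (p %| c i)%Z.
Proof.
pose z i := repr (a i).
pose N := #|{set E}|.
pose M : 'M[int]_(r, N) := \matrix_(i, j) cycle_val (z i) (enum_val j).
have [L Lu [R Ru [d _ MLR]]] := int_Smith_normal_form M.
pose P : 'M[int]_(r, N) := \matrix_(i, j) (i == j :> nat)%:R.
(* The cycles whose coordinates are the rows of L^-1 M = D R. *)
pose u i : zcycle K k := \sum_j z j *~ invmx L i j.
have uP i S : cycle_val (u i) S = d`_i * (P *m R) i (enum_rank S).
  transitivity ((invmx L *m M) i (enum_rank S)).
    rewrite /u raddf_sum sum_ffunE mxE; apply: eq_bigr => j _.
    by rewrite raddfMz /= chainMz mxE enum_rankK mulrC.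
  rewrite MLR -mulmxA mulKmx // !mxE mulr_sumr; apply: eq_bigr => j _.
  by rewrite !mxE mulrA mulr_natr.
have u_neq0 i : u i != 0.
  apply/eqP => ui0.
  have Li0 : forall j, invmx L i j = 0.
    apply: a_ind; rewrite -[RHS](raddf0 (@homology_class E K k)) -ui0 raddf_sum.
    by apply: eq_bigr => j _; rewrite raddfMz /= /homology_class reprK.
  have /matrixP/(_ i i) := mulVmx Lu; rewrite !mxE eqxx big1 => // j _.
  by rewrite Li0 mul0r.
have d_neq0 (i : 'I_r) : d`_i != 0.
  apply: contraNneq (u_neq0 i) => di0; apply/eqP/val_inj/ffunP => S.
  by rewrite /= uP di0 mul0r ffunE.
(* If [i] were at least [N], row [i] of [P] would vanish, and with it the nonzero cycle [u i]. *)
have i_lt (i : 'I_r) : (i < N)%N.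
  rewrite ltnNge; apply: contra (u_neq0 i) => Ni; apply/eqP/val_inj/ffunP => S.
  rewrite /= uP ffunE mxE big1 ?mulr0 // => j _; rewrite mxE.
  by rewrite gtn_eqF ?mul0r // (leq_trans (ltn_ord j)).
pose y i : chain E := [ffun S => (P *m R) i (enum_rank S)].
have yP i : y i \in cycle_on K k.
  apply: (cycle_saturated (d_neq0 i)).
  rewrite (_ : y i *~ _ = cycle_val (u i)) ?cycleP //.
  by apply/ffunP => S; rewrite chainMz uP ffunE mulrC.
exists (fun i => homology_class (Cycle (yP i))) => p c h.
have [w ->] := homology_class_surj h.
have -> : \sum_i homology_class (Cycle (yP i)) *~ c i =
    homology_class (\sum_i Cycle (yP i) *~ c i).
  by rewrite raddf_sum; apply: eq_bigr => i _; rewrite raddfMz.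
rewrite -raddfMn => /class_inj/(congr1 (@cycle_val _ _ _)) cw i.
pose C : 'rV[int]_r := \row_i c i.
pose W : 'rV[int]_N := \row_j cycle_val w (enum_val j).
have CW : C *m (P *m R) = W *+ p.
  apply/rowP => j; have /ffunP/(_ (enum_val j)) := cw.
  rewrite raddf_sum raddfMn /= sum_ffunE ffunMnE mulmxnE !mxE => <-.
  by apply: eq_bigr => l _; rewrite raddfMz /= chainMz ffunE enum_valK !mxE mulrC.
(* Since r <= N, [P] is right invertible, so [c] is read off from [W *m invmx R] and inherits the
   factor [p]. *)
have PP : P *m P^T = 1%:M.
  apply/matrixP => s t; rewrite !mxE (bigD1 (Ordinal (i_lt s))) //= big1 => [|j js].
    by rewrite !mxE /= eqxx mul1r addr0 eq_sym.
  by rewrite !mxE; move: js; rewrite -val_eqE /= eq_sym => /negPf->; rewrite mul0r.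
have : C = (W *m invmx R *m P^T) *+ p.
  by rewrite -scaler_nat !scalemxAl scaler_nat -CW mulmxA mulmxK // -mulmxA PP mulmx1.
move/rowP/(_ i); rewrite mulmxnE mxE => ->.
by rewrite -mulr_natr natz dvdz_mull.
Qed.

End UnimodularBasis.

Lemma zmod_morphism_additive (U V : zmodType) (f : U -> V) :
  zmod_morphism f -> exists g : {additive U -> V}, g =1 f.
Proof.
move=> fB; pose fA := GRing.isZmodMorphism.Build U V f fB.
pose g : {additive U -> V} := HB.pack f fA.
by exists g.
Qed.

(** * Torsion in the image of theta and the final assembly *)

Section ThetaTorsion.
Variables (m k n d p : nat) (G : sgraph 'I_m).
Variable gamma : zcycle (matching_complex (complete_graph n)) d.

(** If p gamma bounds [b], then p times the join of a cycle [z] with gamma bounds the join of [z]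
    with [b], up to the sign (-1)^k of the boundary formula for joins. *)
Lemma theta_exponent h : homology_class gamma *+ p = 0 -> theta G k gamma h *+ p = 0.
Proof.
rewrite -raddfMn => /homology_class_eq0[b bd]; rewrite raddfMn /= => gb.
have [z ->] := homology_class_surj h; rewrite thetaE -raddfMn.
have /andP[zk /eqP bz] := cycleP z.
apply/homology_class_eq0; exists (join z b *~ (-1) ^+ k).
  by apply: rpredMz; rewrite -addnS; exact: (join_chain zk bd).
have join0 c : join (0 : chain {set 'I_m}) c = 0 :> chain {set 'I_(m + n)}.
  by rewrite -{1}(subrr 0) join_zmod_morphisml subrr.
rewrite raddfMn (raddfMz (@boundary _)) /= (join_boundary _ zk) bz join0 add0r.
rewrite -mulrzA -expr2 sqrr_sign mulr1z -gb /join.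
by rewrite (raddfMn (relabel _)) (raddfMn (wedge _)).
Qed.

End ThetaTorsion.

Theorem theorem5p3 (k0 : nat) (G : forall k : nat, sgraph 'I_(k.*2.+1))
    (G_compatible : compatible k0 G) (n d : nat)
    (gamma : zcycle (matching_complex (complete_graph n)) d)
    (p : nat) (p_prime : prime p)
    (theta_inj : injective
       (tensor_map (theta (G k0) k0 gamma) (idfun : {additive 'Z_p -> 'Z_p}))) :
  (forall k, (k0 <= k)%N -> injective
     (tensor_map (theta (G k) k gamma) (idfun : {additive 'Z_p -> 'Z_p})))
  /\
  (has_exponent (homology_class gamma) p -> forall k, (k0 <= k)%N ->
     (exists theta_hat : {additive
          tensor (homology (matching_complex (G k)) k) 'Z_p ->
          homology (matching_complex (complete_graph (k.*2.+1 + n))) (k + d)},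
        (forall (z : homology (matching_complex (G k)) k) (a : int),
           theta_hat (tens z (a%:~R : 'Z_p)) = theta (G k) k gamma (z *~ a)) /\
        injective theta_hat)
     /\
     (exists f : {additive
          'rV['Z_p]_(zrank (homology (matching_complex (G k)) k)) ->
          homology (matching_complex (complete_graph (k.*2.+1 + n))) (k + d)},
        injective f)).
Proof.
have p_gt1 := prime_gt1 p_prime; have p_gt0 := prime_gt0 p_prime.
have theta_dvd k : (k0 <= k)%N -> forall h h',
    theta (G k) k gamma h = h' *+ p -> exists h'', h = h'' *+ p.
  move=> k0k; apply: (theta_dvdP (G k) gamma p_gt0).2.
  rewrite -(subnK k0k); elim: (k - k0)%N => [|j IHj] {k0k}.
    exact/(theta_dvdP (G k0) gamma p_gt0)/tensor_Zp_injective.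
  apply: join_reflects_dvdS IHj => s; apply: (G_compatible (j + k0).+1).
  by rewrite ltnS leq_addl.
split=> [k /theta_dvd|[_ gamma_p _] k /theta_dvd k_dvd].
  by move/tensor_Zp_injective; apply.
have theta_p h : theta (G k) k gamma h *+ p = 0 by exact: theta_exponent.
split.
  pose hat h (b : 'Z_p) := theta (G k) k gamma h *+ b.
  have hat_bi : biadditive hat.
    by split=> *; rewrite /hat ?raddfD ?mulrnDl //=; apply: mulrn_Zp_add.
  have [theta_hat hatE] := zmod_morphism_additive (tensor_lift_zmod_morphism hat_bi).
  exists theta_hat; split=> [z a|].
    by rewrite hatE tensor_liftE // /hat mulrn_Zp_int ?theta_p // raddfMz.
  apply: additive_injective => t; have [h ->] := tens1_surj t.
  rewrite hatE tensor_liftE // /hat => h0; apply/tens1_eq0 => //.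
  (* A class with zero image has image p times 0, so it is divisible by [p] and its tensor with 1
     vanishes. *)
  apply: (k_dvd h 0); rewrite mul0rn -[RHS]h0.
  by rewrite -[1 in RHS]/(1%:R) mulrn_Zp_nat ?theta_p.
have [[a a_ind] _] := homology_zrankP (matching_complex (G k)) k.
(* A maximal independent family is exchanged for one of the same size that stays independent modulo
   [p]. *)
have [y y_ind] := independent_mod (@homology_class_inj _ (G k)) a_ind.
set r := zrank _ in a a_ind y y_ind *.
pose f (v : 'rV['Z_p]_r) := \sum_i theta (G k) k gamma (y i) *+ v 0 i.
have f_add : zmod_morphism f.
  move=> u v; rewrite /f -sumrB; apply: eq_bigr => i _; apply/eqP.
  by rewrite -subr_eq opprK !mxE -mulrn_Zp_add // subrK.
have [fa faE] := zmod_morphism_additive f_add.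
exists fa; apply: additive_injective => v; rewrite faE => fv.
have [|h vh] := k_dvd (\sum_i y i *~ (v 0 i : nat)) 0.
  by rewrite mul0rn -[RHS]fv raddf_sum; apply: eq_bigr => i _; rewrite -pmulrn raddfMn.
apply/rowP => i; have := y_ind p _ h vh i; rewrite mxE /dvdz /= => pv.
(* The representative of a residue is less than [p], so it is 0 once [p] divides it. *)
apply/val_inj/eqP; rewrite /= -[_ == _]negbK -lt0n; apply/negP => v_gt0.
have := dvdn_leq v_gt0 pv; rewrite leqNgt => /negP; apply.
by have := ltn_ord (v 0 i); rewrite {2}(Zp_cast p_gt1).
Qed.
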